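(* Let $P\in\mathbb{C}[x]$ be a nonconstant monic polynomial of degree $d$ and $t\in\mathbb{C}\setminus\{0\}$. Then $\mathcal{D}_{P,t}$ is a linear subspace of $\mathcal{C}_{P,t}$ with $\dim\mathcal{D}_{P,t}=\delta(P)$, where $\delta(P)$ is defined below. Moreover: (i) $0\le\delta(P)\le d-1$, and for every $d\ge1$ and every integer $k$ with $0\le k\le d-1$ there is a monic $P$ of degree $d$ with $\delta(P)=k$, so that $\dim\mathcal{D}_{P,t}=k$ for every $t\neq 0$; (ii) $\delta(P)=0$ if and only if no two distinct roots of $P$ differ by an integer; (iii) $\delta(P)=d-1$ if and only if all roots of $P$ are simple and all lie in a single coset $a+\mathbb{Z}$, $a\in\mathbb{C}$. Consequently, if $t\neq1$ then $\mathcal{A}_P$ admits a nondegenerate twisted trace with respect to $g_t$; if $t=1$, then $\mathcal{A}_P$ admits a nondegenerate twisted trace with respect to $g_1$ if and only if $\delta(P)<d-1$, i.e. if and only if $P$ has a multiple root or has two roots whose difference is not an integer.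
   Context: For $a\in\mathbb{C}$ let $p_a\ge0$ be the multiplicity of $a$ as a root of $P$. $\mathcal{A}_P$ denotes the associative unital $\mathbb{C}$-algebra generated by $u,v,z$ subject to $zu-uz=u$, $zv-vz=-v$, $uv=P(z-\tfrac12)$, $vu=P(z+\tfrac12)$. For $t\in\mathbb{C}\setminus\{0\}$, $g_t$ is the algebra automorphism of $\mathcal{A}_P$ with $g_t(u)=t^{-1}u$, $g_t(v)=tv$, $g_t(z)=z$. A twisted trace (with respect to $g_t$) is a $\mathbb{C}$-linear map $T:\mathcal{A}_P\to\mathbb{C}$ with $T(ab)=T(g_t(b)a)$ for all $a,b\in\mathcal{A}_P$; $\mathcal{C}_{P,t}$ is the vector space of these. $T$ is degenerate if there is $0\neq a\in\mathcal{A}_P$ with $T(ab)=0$ for all $b\in\mathcal{A}_P$, and nondegenerate otherwise; $\mathcal{D}_{P,t}\subseteq\mathcal{C}_{P,t}$ is the set of degenerate twisted traces. Define $\delta(P)=\sum_{c\in\mathbb{C}/\mathbb{Z}}\Big(\sum_{a'\in c}p_{a'}-\max_{a'\in c}p_{a'}\Big)$, where only the finitely many cosets $c$ containing roots of $P$ contribute. *)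

(* Defs.v *)
From HB Require Import structures.
From mathcomp Require Import all_boot all_order all_algebra.
From mathcomp Require Import complex boolp reals.
Set Implicit Arguments. Unset Strict Implicit. Unset Printing Implicit Defensive.
Import Order.TTheory GRing.Theory Num.Theory.
Local Open Scope ring_scope.

(* Generators: 0 = u, 1 = v, 2 = z.  Words = monomials of the free algebra. *)
Definition word := seq 'I_3.
Definition gu : 'I_3 := @Ordinal 3 0 isT.
Definition gv : 'I_3 := @Ordinal 3 1 isT.
Definition gz : 'I_3 := @Ordinal 3 2 isT.

Section FreeAlg.
Variable R : realType.
Local Notation C := (R[i]).

(* An element of the free algebra, as a formal linear combination of words. *)
Definition felem := seq (C * word).
(* Coefficient of the word w (two felems are the same element iff all coefficients agree). *)
Definition fcoef (e : felem) (w : word) : C := \sum_(p <- e | p.2 == w) p.1.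
Definition fword (w : word) : felem := [:: (1, w)].
Definition fmul (a b : felem) : felem :=
  [seq (p.1 * q.1, p.2 ++ q.2) | p <- a, q <- b].
Definition fscale (c : C) (e : felem) : felem := [seq (c * p.1, p.2) | p <- e].
Definition fpoly (Q : {poly C}) : felem :=
  [seq (Q`_k, nseq k gz) | k <- iota 0 (size Q)].

Definition relsAP (P : {poly C}) : seq felem :=
  [:: [:: (1, [:: gz; gu]); (-1, [:: gu; gz]); (-1, [:: gu])];
      [:: (1, [:: gz; gv]); (-1, [:: gv; gz]); (1, [:: gv])];
      (1, [:: gu; gv]) :: fscale (-1) (fpoly (P \Po ('X - (2^-1)%:P)));
      (1, [:: gv; gu]) :: fscale (-1) (fpoly (P \Po ('X + (2^-1)%:P)))].

Definition in_idealAP (P : {poly C}) (e : felem) : Prop :=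
  exists L : seq (felem * felem * felem),
    (forall l, l \in L -> l.1.2 \in relsAP P) /\
    forall w, fcoef e w = fcoef (flatten [seq fmul (fmul l.1.1 l.1.2) l.2 | l <- L]) w.

(* Linear functionals on the free algebra are exactly arbitrary functions on words;
   a linear functional on A_P is one that vanishes on the ideal. *)
Definition functional := word -> C.
Definition feval (T : functional) (e : felem) : C := \sum_(p <- e) p.1 * T p.2.

Definition vanishes_on_ideal (P : {poly C}) (T : functional) : Prop :=
  forall (a b : word) (r : felem), r \in relsAP P ->
    feval T (fmul (fword a) (fmul r (fword b))) = 0.

(* g_t multiplies a word w by t^(#v(w) - #u(w)). *)
Definition gdeg (w : word) : int := (count_mem gv w)%:Z - (count_mem gu w)%:Z.

(* Twisted traces w.r.t. g_t: T(ab) = T(g_t(b) a)  (checked on words, by bilinearity). *)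
Definition twisted_trace (P : {poly C}) (t : C) (T : functional) : Prop :=
  vanishes_on_ideal P T /\
  forall a b : word, T (a ++ b) = t ^ (gdeg b) * T (b ++ a).

Definition degenerate (P : {poly C}) (T : functional) : Prop :=
  exists a : felem, ~ in_idealAP P a /\
    forall b : word, feval T (fmul a (fword b)) = 0.

Definition degenerate_traces (P : {poly C}) (t : C) : functional -> Prop :=
  fun T => twisted_trace P t T /\ degenerate P T.

Definition nondegenerate_trace (P : {poly C}) (t : C) (T : functional) : Prop :=
  twisted_trace P t T /\ ~ degenerate P T.

Definition is_subspace (S : functional -> Prop) : Prop :=
  S (fun _ => 0) /\
  forall (c : C) (f g : functional), S f -> S g -> S (fun w => c * f w + g w).

Definition has_dim (S : functional -> Prop) (n : nat) : Prop :=
  exists B : 'I_n -> functional,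
    (forall i, S (B i)) /\
    (forall c : 'I_n -> C, (forall w, \sum_i c i * B i w = 0) -> forall i, c i = 0) /\
    (forall f, S f -> exists c : 'I_n -> C, forall w, f w = \sum_i c i * B i w).

Definition rootsC (P : {poly C}) : seq C := undup (sval (closed_field_poly_normal P)).

Definition isZ (x : C) : Prop := exists n : int, x = n%:~R.
Definition same_coset (a b : C) : bool := `[< isZ (a - b) >].

(* a is the first element of s in its coset a + Z (one representative per coset). *)
Definition coset_first (s : seq C) (a : C) : bool :=
  all (fun b => ~~ same_coset a b) (take (index a s) s).

Definition deltaP (P : {poly C}) : nat :=
  let s := rootsC P in
  \sum_(a <- s | coset_first s a)
     ((\sum_(b <- s | same_coset a b) mup b P) - \max_(b <- s | same_coset a b) mup b P)%N.

End FreeAlg.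

(* Main.v *)
Require Import Defs.
From HB Require Import structures.
From mathcomp Require Import all_boot all_order all_algebra.
From mathcomp Require Import complex boolp reals.
From mathcomp Require Import ring zify.
Import Order.TTheory GRing.Theory Num.Theory.
Local Open Scope ring_scope.

(** Sending [u] to [x] and [v] to [P(z + 1/2) x^-1] embeds [A_P] into the skew
    Laurent ring [C[z][x, x^-1]], where [x f(z) = f(z - 1) x].  A twisted trace
    vanishes outside weight 0, so it is a linear functional [tau] on [C[z]], and
    the trace condition reads [tau (L (P s)) = 0] for all [s], where
    [L q = q(z - 1/2) - t q(z + 1/2)].  It is degenerate exactly when [tau]
    annihilates a nonzero ideal of [C[z]], that is, when [tau] is a distribution of
    finite support.

    Write [P = M N] where [M] keeps one root of maximal multiplicity in each coset
    of the integers, so that [deg N = delta(P)].  Then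
    [tau |-> (s |-> tau (L (M s)))] is an isomorphism from the degenerate traces
    onto the functionals on [C[z]] killed by [(N)].  It is injective because the
    two extremal points of the support of [tau] in a coset both survive in
    [tau o L], at distinct congruent roots of [M].  It is surjective because,
    modulo functionals of the form [tau o L], a functional supported at a root of
    [P] can be moved to the congruent root of [M].

    Conversely [L] is onto, with kernel 0 if [t <> 1] and the constants if
    [t = 1], so any nonzero functional killed by [(M)], and by [1] if [t = 1], is
    [tau o L] for some [tau], which by the injectivity above is nondegenerate. *)

Set Implicit Arguments.
Unset Strict Implicit.
Unset Printing Implicit Defensive.

(** * Linear functionals on polynomials and the twisted difference operator *)

Section PolyFunctionals.
Variable F : numClosedFieldType.
Implicit Types (p q r s f g M N : {poly F}) (tau sigma rho : {poly F} -> F).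

Definition shiftp (c : F) p := p \Po ('X + c%:P).

Lemma shiftpD c p q : shiftp c (p + q) = shiftp c p + shiftp c q.
Proof. exact: comp_polyD. Qed.

Lemma shiftpB c p q : shiftp c (p - q) = shiftp c p - shiftp c q.
Proof. exact: comp_polyB. Qed.

Lemma shiftpM c p q : shiftp c (p * q) = shiftp c p * shiftp c q.
Proof. exact: comp_polyM. Qed.

Lemma shiftpZ c a p : shiftp c (a *: p) = a *: shiftp c p.
Proof. exact: comp_polyZ. Qed.

Lemma shiftpC c a : shiftp c a%:P = a%:P.
Proof. exact: comp_polyC. Qed.

Lemma shiftp1 c : shiftp c 1 = 1.
Proof. exact: shiftpC. Qed.

Lemma shiftpX c : shiftp c 'X = 'X + c%:P.
Proof. exact: comp_polyX. Qed.

Lemma shiftpXn c p n : shiftp c (p ^+ n) = shiftp c p ^+ n.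
Proof. exact: rmorphXn. Qed.

Lemma shiftp_shiftp a b p : shiftp a (shiftp b p) = shiftp (a + b) p.
Proof.
rewrite /shiftp -comp_polyA comp_polyD comp_polyX comp_polyC.
by rewrite -addrA -polyCD.
Qed.

Lemma shiftp0 p : shiftp 0 p = p.
Proof. by rewrite /shiftp addr0 comp_polyXr. Qed.

Lemma shiftpK c p : shiftp (- c) (shiftp c p) = p.
Proof. by rewrite shiftp_shiftp addNr shiftp0. Qed.

Lemma shiftpNK c p : shiftp c (shiftp (- c) p) = p.
Proof. by rewrite shiftp_shiftp addrN shiftp0. Qed.

Lemma shiftp_eq0 c p : (shiftp c p == 0) = (p == 0).
Proof.
apply/eqP/eqP => [h|->]; last by rewrite /shiftp comp_poly0.
by rewrite -(shiftpK c p) h /shiftp comp_poly0.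
Qed.

Lemma size_shiftp c p : size (shiftp c p) = size p.
Proof. by rewrite size_comp_poly2 // size_XaddC. Qed.

Lemma lead_coef_shiftp c p : lead_coef (shiftp c p) = lead_coef p.
Proof.
rewrite lead_coef_comp ?size_XaddC // (eqP (monicXaddC c)) expr1n mulr1 //.
Qed.

Lemma horner_shiftp c p x : (shiftp c p).[x] = p.[x + c].
Proof. by rewrite horner_comp hornerD hornerX hornerC. Qed.

Definition lin tau := forall c p q, tau (c *: p + q) = c * tau p + tau q.

Section Lin.
Variable tau : {poly F} -> F.
Hypothesis tau_lin : lin tau.

Lemma lin0 : tau 0 = 0.
Proof.
have := tau_lin (-1) 0 0; rewrite scaler0 addr0 mulN1r => ->.
exact: addNr.
Qed.

Lemma linZ c p : tau (c *: p) = c * tau p.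
Proof. by rewrite -[c *: p]addr0 tau_lin lin0 addr0. Qed.

Lemma linD p q : tau (p + q) = tau p + tau q.
Proof. by rewrite -{1}[p]scale1r tau_lin mul1r. Qed.

Lemma linB p q : tau (p - q) = tau p - tau q.
Proof. by rewrite linD -scaleN1r linZ mulN1r. Qed.

Lemma lin_sum I (l : seq I) (Q : pred I) (G : I -> {poly F}) :
  tau (\sum_(i <- l | Q i) G i) = \sum_(i <- l | Q i) tau (G i).
Proof. by apply: (big_morph tau linD lin0). Qed.

Lemma lin_coef p : tau p = \sum_(k < size p) p`_k * tau 'X^k.
Proof.
rewrite -[in LHS](coefK p) poly_def lin_sum; apply: eq_bigr => i _.
exact: linZ.
Qed.

Lemma lin_mulr_eq0 f : (forall k, tau (f * 'X^k) = 0) -> forall r, tau (f * r) = 0.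
Proof.
move=> h r; rewrite -(coefK r) poly_def mulr_sumr lin_sum big1 // => i _.
by rewrite -scalerAr linZ h mulr0.
Qed.

End Lin.

Lemma lin_mul tau g : lin tau -> lin (fun q => tau (g * q)).
Proof. by move=> h c p q; rewrite mulrDr -scalerAr h. Qed.

Lemma lin_shiftp tau c : lin tau -> lin (fun q => tau (shiftp c q)).
Proof. by move=> h a p q; rewrite shiftpD shiftpZ h. Qed.

Lemma lin_comb tau sigma c :
  lin tau -> lin sigma -> lin (fun q => c * tau q + sigma q).
Proof. by move=> h h' a p q; rewrite h h'; ring. Qed.

Lemma lin_sum_fun n (c : 'I_n -> F) (tau : 'I_n -> {poly F} -> F) :
  (forall i, lin (tau i)) -> lin (fun q => \sum_i c i * tau i q).
Proof.
move=> h a p q; rewrite mulr_sumr -big_split; apply: eq_bigr => i _ /=.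
by rewrite h; ring.
Qed.

(* The distributions of finite support. *)
Definition fsupp tau := exists2 f, f != 0 & forall r, tau (f * r) = 0.

Lemma fsupp_comb tau sigma c :
  fsupp tau -> fsupp sigma -> fsupp (fun q => c * tau q + sigma q).
Proof.
move=> [f f0 hf] [g g0 hg]; exists (f * g); first by rewrite mulf_neq0.
move=> r; rewrite -{1}mulrA hf (_ : f * g * r = g * (f * r)) ?hg ?mulr0 ?addr0 //.
by rewrite mulrA [g * f]mulrC.
Qed.

Lemma fsupp_shiftp tau c : fsupp tau -> fsupp (fun q => tau (shiftp c q)).
Proof.
move=> [f f0 hf]; exists (shiftp (- c) f); first by rewrite shiftp_eq0.
by move=> r; rewrite shiftpM shiftpNK hf.
Qed.

Lemma fsupp0 : fsupp (fun=> 0).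
Proof. by exists 1; rewrite ?oner_eq0. Qed.

Lemma lin_zero : lin (fun=> 0).
Proof. by move=> c p q; rewrite mulr0 addr0. Qed.

Lemma fsupp_sum n (c : 'I_n -> F) (tau : 'I_n -> {poly F} -> F) :
  (forall i, fsupp (tau i)) -> fsupp (fun q => \sum_i c i * tau i q).
Proof.
elim: n c tau => [|n IH] c tau h.
  by case: fsupp0 => f f0 hf; exists f => // r; rewrite big_ord0.
have [f f0 hf] := fsupp_comb (c ord0) (h ord0)
  (IH (fun i => c (lift ord0 i)) (fun i => tau (lift ord0 i)) (fun i => h _)).
by exists f => // r; rewrite big_ord_recl hf.
Qed.

(** * The twisted difference operator on functionals of finite support *)

Section Difference.
Variable t : F.

Definition tdiff q := shiftp (- 2^-1) q - t *: shiftp 2^-1 q.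

Lemma tdiff_lin c p q : tdiff (c *: p + q) = c *: tdiff p + tdiff q.
Proof.
rewrite /tdiff !shiftpD !shiftpZ !scalerDr !scalerN !scalerA [c * t]mulrC.
by rewrite opprD addrACA.
Qed.

Lemma tdiffD p q : tdiff (p + q) = tdiff p + tdiff q.
Proof. by rewrite -{1}[p]scale1r tdiff_lin scale1r. Qed.

Hypothesis t_neq0 : t != 0.

Lemma half_half : 2^-1 + 2^-1 = 1 :> F.
Proof. by rewrite [RHS]splitr !mul1r. Qed.

(** The points [x + e *+ k] are pairwise distinct, so a nonzero [f] cannot vanish at all of them;
    [k.+1] is the first index where it does not. *)
Lemma exists_last_root f x (e : F) : e != 0 -> f != 0 -> root f x ->
  exists k : nat, root f (x + e *+ k) /\ ~~ root f (x + e *+ k.+1).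
Proof.
move=> e0 f0 fx.
have ex : exists k, ~~ root f (x + e *+ k).
  apply: contrapT => hn.
  pose l := [seq x + e *+ k | k <- iota 0 (size f)].
  have ul : uniq l.
    rewrite map_inj_uniq ?iota_uniq // => i j /addrI /eqP.
    rewrite -!(mulr_natl e) (inj_eq (mulIf e0)) eqr_nat.
    by move=> /eqP.
  have al : all (root f) l.
    apply/allP => y /mapP[k _ ->]; apply/negPn/negP => h.
    by apply: hn; exists k.
  by have := max_poly_roots f0 al ul; rewrite size_map size_iota ltnn.
case: (ex_minnP ex) => [[|k]] hk hmin; first by rewrite mulr0n addr0 fx in hk.
exists k; split => //; apply/negPn/negP => h.
by have := hmin _ h; rewrite ltnn.
Qed.

(** The annihilator of [tau] is a nonzero ideal of a principal ideal domain; a nonzero element of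
    least size generates it, by Euclidean division. *)
Lemma min_annihilator tau : lin tau -> fsupp tau ->
  exists2 f, f != 0 & forall g, (forall r, tau (g * r) = 0) <-> f %| g.
Proof.
move=> tl [f0 f0n hf0].
have ex : exists n, `[< exists f, [/\ f != 0, size f = n & forall r, tau (f * r) = 0] >].
  by exists (size f0); apply/asboolP; exists f0.
case: (ex_minnP ex) => n /asboolP[f [fn sf hf]] hmin.
exists f => // g; split=> [hg|/dvdpP[q ->] r]; last by rewrite [q * f]mulrC -mulrA hf.
apply/negPn/negP; rewrite /dvdp => gf0.
have : (n <= size (g %% f)%R)%N.
  apply: hmin; apply/asboolP; exists (g %% f); split => // r.
  have -> : g %% f = g - (g %/ f) * f by apply/eqP; rewrite eq_sym subr_eq addrC -divp_eq.
  by rewrite mulrBl (linB tl) hg -mulrA mulrCA hf subr0.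
by rewrite leqNgt -sf ltn_modp fn.
Qed.

(* The lowest and the highest point of the support of [tau] in a coset of the
   integers survive in the difference, half a step outside; hence [tau \o tdiff]
   cannot be supported on a single point of each coset. *)
Lemma fsupp_tdiff_eq0 tau M : lin tau -> fsupp tau ->
  (forall a (n : nat), root M a -> root M (a + n%:R) -> n = 0%N) ->
  (forall s, tau (tdiff (M * s)) = 0) -> forall q, tau q = 0.
Proof.
move=> tl ts hM hk.
have [f f0 hf] := min_annihilator tl ts.
have hff r : tau (f * r) = 0 by apply: (proj2 (hf f)).
have [sf|sf] := eqVneq (size f) 1.
  have /size_poly1P[c c0 fc] := introT eqP sf.
  move=> q; have := hff (c^-1 *: q).
  by rewrite fc mul_polyC scalerA divff // scale1r.
have [x fx] := closed_rootP f sf.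
have m1_neq0 : -1 != 0 :> F by rewrite oppr_eq0 oner_neq0.
(* The test polynomial is chosen so that one of the two shifts in [tdiff] produces a factor [f],
   which [tau] kills; the other shift then lies in the annihilator. [d2] is the mirror image. *)
have d1 : f %| shiftp (- 2^-1) M * shiftp (- 1) f.
  apply/(hf _) => r.
  have := hk (shiftp (- 2^-1) f * shiftp 2^-1 r).
  rewrite /tdiff !shiftpM !shiftp_shiftp -opprD half_half addrN addNr !shiftp0.
  rewrite (linB tl) (linZ tl) [_ * (f * _)]mulrCA hff mulr0 subr0.
  by rewrite mulrA.
have d2 : f %| shiftp 2^-1 M * shiftp 1 f.
  apply/(hf _) => r.
  have := hk (shiftp 2^-1 f * shiftp (- 2^-1) r).
  rewrite /tdiff !shiftpM !shiftp_shiftp half_half addrN addNr !shiftp0.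
  rewrite (linB tl) (linZ tl) [_ * (f * _)]mulrCA hff sub0r mulrA => /eqP.
  by rewrite oppr_eq0 mulf_eq0 (negPf t_neq0) => /eqP.
(* At [x - i] the left side of [d1] must vanish while [f] is nonzero at [x - i - 1], so [M] vanishes
   at [x - i - 1/2]. Likewise [M] vanishes at [x + j + 1/2], and these two roots differ by
   [i + j + 1]. *)
have [i [fi fi1]] := exists_last_root (e := -1) m1_neq0 f0 fx.
have [j [fj fj1]] := exists_last_root (oner_neq0 F) f0 fx.
have M1 : root M (x + (-1) *+ i - 2^-1).
  have /dvdpP[q /(congr1 (horner^~ (x + (-1) *+ i)))] := d1.
  rewrite !hornerM !horner_shiftp (rootP fi) mulr0 => /eqP.
  rewrite mulf_eq0 => /orP[//|]; rewrite -addrA -mulrSr => h.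
  by rewrite [root _ _]h in fi1.
have M2 : root M (x + 1 *+ j + 2^-1).
  have /dvdpP[q /(congr1 (horner^~ (x + 1 *+ j)))] := d2.
  rewrite !hornerM !horner_shiftp (rootP fj) mulr0 => /eqP.
  rewrite mulf_eq0 => /orP[//|]; rewrite -addrA -mulrSr => h.
  by rewrite [root _ _]h in fj1.
have := hM _ (i + j).+1 M1.
have -> : x + -1 *+ i - 2^-1 + (i + j).+1%:R = x + 1 *+ j + 2^-1.
  rewrite mulNrn -addSn natrD -natr1 -!addrA; congr (x + _).
  by field.
by move=> /(_ M2).
Qed.

(** A telescoping sum: the translate of [sigma] by [n + 1/2], scaled by [t ^+ n], contributes the
    step from [n] to [n.+1]. *)
Lemma shift_mod_tdiff_nat sigma (n : nat) : lin sigma -> fsupp sigma ->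
  exists tau, [/\ lin tau, fsupp tau &
    forall q, tau (tdiff q) = sigma q - t ^+ n * sigma (shiftp n%:R q)].
Proof.
move=> sl ss; elim: n => [|n [tau [tl ts h]]].
  exists (fun=> 0); split=> [||q]; [exact: lin_zero|exact: fsupp0|].
  by rewrite expr0 mul1r shiftp0 subrr.
exists (fun q => t ^+ n * sigma (shiftp (n%:R + 2^-1) q) + tau q); split.
- by apply: lin_comb => //; apply: lin_shiftp.
- by apply: fsupp_comb => //; apply: fsupp_shiftp.
move=> q; rewrite h /tdiff shiftpB shiftpZ !shiftp_shiftp addrK -addrA half_half.
by rewrite natr1 (linB sl) (linZ sl) exprS; ring.
Qed.

Lemma shift_mod_tdiff sigma (n : int) : lin sigma -> fsupp sigma ->
  exists tau, [/\ lin tau, fsupp tau &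
    forall q, tau (tdiff q) = sigma q - t ^ n * sigma (shiftp n%:~R q)].
Proof.
move=> sl ss; case: n => n; first exact: shift_mod_tdiff_nat.
(* For a negative shift, the natural case is applied to [sigma] already translated by [- n.+1], and
   the result is divided by [- t ^+ n.+1]. *)
have [tau [tl ts h]] := shift_mod_tdiff_nat n.+1
  (lin_shiftp (- n.+1%:R) sl) (fsupp_shiftp (- n.+1%:R) ss).
exists (fun q => - t ^- n.+1 * tau q + 0); split.
- by apply: lin_comb => //; apply: lin_zero.
- by apply: fsupp_comb => //; apply: fsupp0.
move=> q; rewrite h shiftpK NegzE mulrNz -exprnN addr0 /=.
by field; rewrite expf_neq0.
Qed.

(** Induction on the points supporting [sigma]. A Bezout identity separates the part at [a] from the
    rest; that part can be translated by [n], modulo functionals [tau \o tdiff], to a point where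
    [M] vanishes to order at least [e a], and there it kills every multiple of [M]. *)
Lemma fsupp_decomp sigma M (l : seq F) (e : F -> nat) : lin sigma -> uniq l ->
  M != 0 ->
  (forall r, sigma (\prod_(a <- l) ('X - a%:P) ^+ e a * r) = 0) ->
  (forall a, a \in l -> exists n : int, ('X - (a + n%:~R)%:P) ^+ e a %| M) ->
  exists tau, [/\ lin tau, fsupp tau &
    forall s, tau (tdiff (M * s)) = sigma (M * s)].
Proof.
move=> sl ul M0; elim: l ul sigma sl => [|a l IH] /= ul sigma sl hs hd.
  exists (fun=> 0); split=> [||s]; [exact: lin_zero|exact: fsupp0|].
  by rewrite -[M * s]mul1r -(hs (M * s)) big_nil.
case/andP: ul => al ul.
set A := ('X - a%:P) ^+ e a; set B := \prod_(b <- l) ('X - b%:P) ^+ e b.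
have hAB r : sigma (A * B * r) = 0 by rewrite -(hs r) big_cons.
have cAB : coprimep A B.
  apply: coprimep_expl; rewrite coprimep_sym coprimep_XsubC /B.
  elim: (l) al => [|b l' IHl]; first by rewrite big_nil root1.
  rewrite inE negb_or big_cons rootM negb_or => /andP[ab al'].
  rewrite IHl // andbT; case: (e b) => [|k]; first by rewrite expr0 root1.
  by rewrite /root hornerE expf_eq0 /= !hornerE subr_eq0.
have [[u v] /= uv] := Bezout_eq1_coprimepP _ _ cAB.
have [n An] := hd a (mem_head _ _).
have [tau2 [t2l t2s h2]] : exists tau, [/\ lin tau, fsupp tau &
    forall s, tau (tdiff (M * s)) = sigma (u * A * (M * s))].
  apply: (IH ul (fun q => sigma (u * A * q))); first exact: lin_mul.
    move=> r; rewrite -/B (_ : u * A * (B * r) = A * B * (u * r)) ?hAB //; ring.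
  by move=> b bl; apply: hd; rewrite inE bl orbT.
have s1l : lin (fun q => sigma (v * B * q)) by exact: lin_mul.
have s1A r : sigma (v * B * (A * r)) = 0.
  by rewrite (_ : v * B * (A * r) = A * B * (v * r)) ?hAB //; ring.
have s1s : fsupp (fun q => sigma (v * B * q)).
  by exists A => //; rewrite expf_neq0 // polyXsubC_eq0.
have [tau1 [t1l t1s h1]] := shift_mod_tdiff n s1l s1s.
exists (fun q => 1 * tau1 q + tau2 q); split.
- exact: lin_comb.
- exact: fsupp_comb.
(* The translated part drops out because [A] divides the shift of [M] by [n]; the two remaining
   parts add up to [sigma] by [uv]. *)
move=> s; rewrite mul1r h1 h2 (_ : sigma (v * B * shiftp _ _) = 0).
  by rewrite mulr0 subr0 -(linD sl) -mulrDl addrC uv mul1r.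
have [w ->] := dvdpP _ _ An.
rewrite !shiftpM shiftpXn shiftpB shiftpX shiftpC.
rewrite (_ : 'X + _ - _ = 'X - a%:P); last by rewrite polyCD; ring.
by rewrite -/A (_ : _ * A * _ = A * (shiftp n%:~R w * shiftp n%:~R s)) ?s1A //; ring.
Qed.

Lemma fsupp_tdiff_surj rho M N (l : seq F) (e : F -> nat) : lin rho -> uniq l ->
  M != 0 -> M * N = \prod_(a <- l) ('X - a%:P) ^+ e a ->
  (forall r, rho (N * r) = 0) ->
  (forall a, a \in l -> exists n : int, ('X - (a + n%:~R)%:P) ^+ e a %| M) ->
  exists tau, [/\ lin tau, fsupp tau & forall s, tau (tdiff (M * s)) = rho s].
Proof.
move=> rl ul M0 MN hr hd.
(* Dividing by [M] extends [rho] to a functional that is killed by [M * N] and takes the value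
   [rho s] at [M * s]. *)
have [||tau [tl ts h]] := @fsupp_decomp (fun q => rho (q %/ M)) M l e _ ul M0 _ hd.
- by move=> c p q; rewrite divpD divpZl rl.
- by move=> r; rewrite -MN -mulrA mulKp.
by exists tau; split => // s; rewrite h mulKp.
Qed.

End Difference.

(** * Image and kernel of the twisted difference operator *)

Lemma triangular_surj (L : {poly F} -> {poly F}) :
  (forall c p q, L (c *: p + q) = c *: L p + L q) ->
  (forall n, exists p, size (L p) = n.+1) -> forall q, exists p, L p = q.
Proof.
move=> hL hn q; have [n] := ubnP (size q); elim: n q => // n IH q sq.
have [->|q0] := eqVneq q 0.
  (* Zero is written in this form so that [hL] alone gives [L 0 - L 0 = 0]. *)
  exists ((-1) *: 0 + 0).
  by rewrite hL scaleN1r addNr.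
have [p sp] := hn (size q).-1.
have sp' : size (L p) = size q by rewrite sp prednK // lt0n size_poly_eq0.
pose c := lead_coef q / lead_coef (L p).
have [|p' hp'] := IH (q - c *: L p).
  apply: (@leq_trans (size q)) => //.
  have lp0 : lead_coef (L p) != 0 by rewrite lead_coef_eq0 -size_poly_eq0 sp.
  rewrite -[X in (_ < X)%N](prednK (n := size q)) ?lt0n ?size_poly_eq0 // ltnS.
  apply/leq_sizeP => j; rewrite leq_eqVlt => /predU1P[<-|jq].
    rewrite coefB coefZ /c {2}/lead_coef sp' -lead_coefE mulfVK ?subrr //.
    by move: lp0; rewrite /lead_coef sp'.
  have sj : (size q <= j)%N by rewrite -[size q]prednK ?lt0n ?size_poly_eq0.
  by rewrite coefB coefZ !nth_default ?sp' // mulr0 subrr.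
by exists (c *: p + p'); rewrite hL hp' addrC subrK.
Qed.

Lemma coef_XaddC_exp (c : F) n : (('X + c%:P) ^+ n.+1)`_n = c *+ n.+1.
Proof.
elim: n => [|n IH]; first by rewrite expr1 coefD coefX coefC add0r.
rewrite exprSr mulrDr coefD coefMX coefMC /= IH.
have sz : size (('X + c%:P) ^+ n.+1) = n.+2.
  by rewrite -[c%:P]opprK -polyCN size_exp_XsubC.
have : ('X + c%:P) ^+ n.+1 \is monic by rewrite monic_exp // monicXaddC.
rewrite monicE lead_coefE sz /= => /eqP ->.
by rewrite mul1r -mulrSr.
Qed.

(** If [t != 1], the image of ['X^n] has leading coefficient [1 - t] in degree [n]. If [t = 1], the
    top terms cancel and the image of ['X^(n.+1)] has degree [n], with leading coefficient
    [- n.+1]. *)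
Lemma tdiff_surj (t : F) q : exists p, tdiff t p = q.
Proof.
apply: triangular_surj => [|n]; first exact: tdiff_lin.
have [->|t1] := eqVneq t 1; last first.
  exists 'X^n; rewrite /tdiff.
  have lc c : (shiftp c 'X^n)`_n = 1.
    have := lead_coef_shiftp c 'X^n.
    by rewrite lead_coefXn lead_coefE size_shiftp size_polyXn.
  apply/eqP; rewrite eqn_leq; apply/andP; split.
    apply: (leq_trans (size_polyD _ _)); rewrite geq_max size_shiftp size_polyXn leqnn.
    by rewrite size_polyN (leq_trans (size_scale_leq _ _)) // size_shiftp size_polyXn.
  rewrite ltnNge; apply/negP => /leq_sizeP/(_ n (leqnn _))/eqP.
  by rewrite coefB coefZ !lc mulr1 subr_eq0 eq_sym (negPf t1).
exists 'X^(n.+1); rewrite /tdiff scale1r.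
have lc c : (shiftp c 'X^(n.+1))`_n.+1 = 1.
  have := lead_coef_shiftp c 'X^(n.+1).
  by rewrite lead_coefXn lead_coefE size_shiftp size_polyXn.
apply/eqP; rewrite eqn_leq; apply/andP; split.
  apply/leq_sizeP => j; rewrite leq_eqVlt => /predU1P[<-|jn].
    by rewrite coefB !lc subrr.
  by rewrite coefB !nth_default ?subrr // size_shiftp size_polyXn.
rewrite ltnNge; apply/negP => /leq_sizeP/(_ n (leqnn _))/eqP.
rewrite coefB !shiftpXn !shiftpX !coef_XaddC_exp -mulrnBl mulrn_eq0 /=.
by rewrite -opprD half_half oppr_eq0 oner_eq0.
Qed.

Lemma tdiff_ker_neq1 (t : F) p : t != 1 -> tdiff t p = 0 -> p = 0.
Proof.
move=> t1 /(congr1 (fun q : {poly F} => q`_(size p).-1)).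
have lc c : (shiftp c p)`_(size p).-1 = lead_coef p.
  by rewrite -(lead_coef_shiftp c p) lead_coefE size_shiftp.
rewrite coefB coefZ !lc coef0 -{1}[lead_coef p]mul1r -mulrBl => /eqP.
by rewrite mulf_eq0 subr_eq0 eq_sym (negPf t1) /= lead_coef_eq0 => /eqP.
Qed.

(** Such a [p] has period 1, so [p - p.[0]] vanishes at every natural number. *)
Lemma tdiff_ker1 p : tdiff 1 p = 0 -> exists c, p = c%:P.
Proof.
move/eqP; rewrite /tdiff scale1r subr_eq0 => /eqP h.
have per : shiftp 1 p = p.
  rewrite -half_half -shiftp_shiftp -h shiftpNK //.
exists p.[0]; apply/eqP; rewrite -subr_eq0; apply/negPn/negP => p0.
have [|k [hk]] := @exists_last_root (p - p.[0]%:P) 0 1 (oner_neq0 _) p0.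
  by rewrite /root !hornerE subrr.
move/negP; apply; rewrite mulrSr addrA; move: hk; rewrite /root !hornerE.
by rewrite -horner_shiftp per.
Qed.

(** Preimages under [tdiff] are chosen arbitrarily; [sigma] does not see the choice, since it kills
    the kernel. *)
Lemma lift_tdiff (t : F) sigma : lin sigma ->
  (forall p, tdiff t p = 0 -> sigma p = 0) ->
  exists2 tau, lin tau & forall q, tau (tdiff t q) = sigma q.
Proof.
move=> sl hk; have [G hG] := choice (tdiff_surj t).
have hs p q : tdiff t p = tdiff t q -> sigma p = sigma q.
  move=> e; apply/eqP; rewrite -subr_eq0 -(linB sl); apply/eqP/hk.
  by rewrite -scaleN1r addrC tdiff_lin scaleN1r e addNr.
exists (fun q => sigma (G q)) => [c p q|q]; last exact: hs.
by rewrite -sl; apply: hs; rewrite tdiff_lin !hG.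
Qed.

End PolyFunctionals.

(** * The defining ideal *)

Section Words.
Variable R : realType.
Local Notation C := (R[i]).
Local Notation felem := (felem R).
Local Notation functional := (functional R).
Implicit Types (a b e r : felem) (T : functional) (p q f : {poly C}).

Lemma feval_cat T a b : feval T (a ++ b) = feval T a + feval T b.
Proof. by rewrite /feval big_cat. Qed.

Lemma feval_scale T c e : feval T (fscale c e) = c * feval T e.
Proof. by rewrite /feval big_map mulr_sumr; apply: eq_bigr => x _; rewrite mulrA. Qed.

Lemma feval_word T w : feval T (fword R w) = T w.
Proof. by rewrite /feval big_seq1 mul1r. Qed.

Lemma feval_mul T a b :
  feval T (fmul a b) = feval (fun x => feval (fun y => T (x ++ y)) b) a.
Proof.
rewrite /feval /fmul big_allpairs_dep; apply: eq_bigr => x _ /=.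
by rewrite mulr_sumr; apply: eq_bigr => y _ /=; rewrite mulrA.
Qed.

Lemma feval_flatten T (l : seq felem) : feval T (flatten l) = \sum_(x <- l) feval T x.
Proof. by elim: l => [|x l IH] /=; rewrite ?big_nil /feval ?big_nil // big_cons -IH -big_cat. Qed.

Lemma feval_poly T q : feval T (fpoly q) = \sum_(k < size q) q`_k * T (nseq k gz).
Proof. by rewrite /feval /fpoly big_map -[X in iota _ X]subn0 big_mkord. Qed.

Lemma feval_polyD T c p q :
  feval T (fpoly (c *: p + q)) = c * feval T (fpoly p) + feval T (fpoly q).
Proof.
(* The lists [fpoly p] and [fpoly q] have lengths depending on the degrees, so all sums are padded
   to a common length. *)
pose m := maxn (size (c *: p + q)) (maxn (size p) (size q)).
have E (s : {poly C}) : (size s <= m)%N ->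
    feval T (fpoly s) = \sum_(k < m) s`_k * T (nseq k gz).
  move=> sm; rewrite feval_poly (big_ord_widen m (fun k => s`_k * T (nseq k gz))) //.
  rewrite [RHS](bigID (fun k : 'I_m => (k < size s)%N)) /=.
  rewrite [X in _ + X]big1 ?addr0 // => k; rewrite -leqNgt => h.
  by rewrite nth_default ?mul0r.
rewrite !E ?leq_max ?leqnn ?orbT // mulr_sumr -big_split.
by apply: eq_bigr => k _ /=; rewrite coefD coefZ; ring.
Qed.

Lemma feval_fcoef e w : fcoef e w = feval (fun x => (x == w)%:R) e.
Proof.
rewrite /fcoef /feval big_mkcond; apply: eq_bigr => x _.
by case: eqP; rewrite ?mulr1 ?mulr0.
Qed.

Lemma big_fiber (V : nmodType) (I J : eqType) (g : I -> J) (l : seq I) (s : seq J)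
    (h : I -> V) : uniq s -> {subset map g l <= s} ->
  \sum_(x <- l) h x = \sum_(j <- s) \sum_(x <- l | g x == j) h x.
Proof.
move=> us sub; rewrite (exchange_big_dep xpredT) //=.
apply: eq_big_seq => x xl.
rewrite big_mkcond (bigD1_seq (g x)) ?sub ?map_f //= eqxx big1 ?addr0 // => j.
by rewrite eq_sym => /negPf ->.
Qed.

(** Grouping terms by word makes evaluation depend on the coefficients only. With [feval_fcoef],
    identities in the free algebra can thus be tested against all functionals instead of on
    lists. *)
Lemma feval_ext e e' : (forall w, fcoef e w = fcoef e' w) ->
  forall T, feval T e = feval T e'.
Proof.
move=> h T; pose s := undup ([seq x.2 | x <- e] ++ [seq x.2 | x <- e']).
have E d : {subset [seq x.2 | x <- d] <= s} -> feval T d = \sum_(w <- s) fcoef d w * T w.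
  move=> sub; rewrite /feval (big_fiber _ (undup_uniq _) sub).
  apply: eq_bigr => w _; rewrite /fcoef mulr_suml.
  by apply: eq_bigr => x /eqP ->.
rewrite !E; first by apply: eq_bigr => w _; rewrite h.
  by move=> w; rewrite mem_undup mem_cat orbC => ->.
by move=> w; rewrite mem_undup mem_cat => ->.
Qed.

Section Ideal.
Variable P : {poly C}.

Lemma ideal_ext e e' : (forall T, feval T e = feval T e') ->
  in_idealAP P e -> in_idealAP P e'.
Proof.
move=> h [L [hL hw]]; exists L; split => // w.
by rewrite -hw !feval_fcoef h.
Qed.

Lemma ideal0 : in_idealAP P [::].
Proof. by exists [::]. Qed.

Lemma ideal_cat e e' : in_idealAP P e -> in_idealAP P e' -> in_idealAP P (e ++ e').
Proof.
move=> [L [hL hw]] [L' [hL' hw']]; exists (L ++ L'); split.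
  by move=> l; rewrite mem_cat => /orP[]; [apply: hL|apply: hL'].
move=> w; rewrite map_cat flatten_cat /fcoef !big_cat.
by congr (_ + _); [apply: hw | apply: hw'].
Qed.

Lemma feval_ideal_gen T (L : seq (felem * felem * felem)) :
  feval T (flatten [seq fmul (fmul l.1.1 l.1.2) l.2 | l <- L]) =
  \sum_(l <- L) feval (fun x => feval (fun y => feval (fun z => T ((x ++ y) ++ z))
     l.2) l.1.2) l.1.1.
Proof.
rewrite feval_flatten big_map; apply: eq_bigr => l _.
by rewrite !feval_mul.
Qed.

Lemma ideal_mull e d : in_idealAP P e -> in_idealAP P (fmul d e).
Proof.
move=> [L [hL hw]]; exists [seq ((fmul d l.1.1, l.1.2), l.2) | l <- L]; split.
  by move=> l /mapP[l' /hL ? ->].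
move=> w; rewrite !feval_fcoef feval_ideal_gen feval_mul big_map.
under [LHS]eq_bigr => x _.
  rewrite (feval_ext hw) feval_ideal_gen mulr_sumr; over.
rewrite exchange_big; apply: eq_bigr => l _ /=.
rewrite feval_mul; apply: eq_bigr => x _; congr (_ * _).
apply: eq_bigr => y _; congr (_ * _); apply: eq_bigr => z _; congr (_ * _).
by apply: eq_bigr => u _; rewrite !catA.
Qed.

Lemma ideal_mulr e d : in_idealAP P e -> in_idealAP P (fmul e d).
Proof.
move=> [L [hL hw]]; exists [seq ((l.1.1, l.1.2), fmul l.2 d) | l <- L]; split.
  by move=> l /mapP[l' /hL ? ->].
move=> w; rewrite !feval_fcoef feval_ideal_gen feval_mul big_map.
rewrite (feval_ext hw) feval_ideal_gen.
apply: eq_bigr => l _ /=; apply: eq_bigr => x _; congr (_ * _).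
apply: eq_bigr => y _; congr (_ * _); rewrite feval_mul.
apply: eq_bigr => z _; congr (_ * _).
by apply: eq_bigr => u _; rewrite !catA.
Qed.

Lemma ideal_scale e c : in_idealAP P e -> in_idealAP P (fscale c e).
Proof.
move=> /(ideal_mull [:: (c, [::])]); apply: ideal_ext => T.
by rewrite feval_mul feval_scale /feval big_seq1.
Qed.

Lemma ideal_rel r : r \in relsAP P -> in_idealAP P r.
Proof.
move=> hr; exists [:: ((fword R [::], r), fword R [::])]; split.
  by move=> l; rewrite inE => /eqP ->.
move=> w; rewrite !feval_fcoef feval_ideal_gen big_seq1 feval_word.
by apply: eq_bigr => x _; rewrite feval_word cats0.
Qed.

Lemma vanishes_ideal T e : vanishes_on_ideal P T -> in_idealAP P e -> feval T e = 0.
Proof.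
move=> hT [L [hL hw]]; rewrite (feval_ext hw) feval_ideal_gen big_seq big1 // => l lL.
rewrite /feval big1 // => x _.
(* By linearity in the outer factors, it suffices to treat a relation between two words, which is
   the hypothesis on [T]. *)
suff -> : \sum_(p <- l.1.2) p.1 * (\sum_(p0 <- l.2) p0.1 * T ((x.2 ++ p.2) ++ p0.2)) = 0
  by rewrite mulr0.
under eq_bigr => y _ do rewrite mulr_sumr.
rewrite exchange_big big1 // => z _ /=.
have := hT x.2 z.2 _ (hL _ lL); rewrite feval_mul feval_word feval_mul.
rewrite /feval => /(congr1 (fun u => z.1 * u)); rewrite mulr0 => h.
apply: etrans h; rewrite mulr_sumr.
apply: eq_bigr => y _; rewrite big_seq1 mul1r catA; ring.
Qed.

Definition eqA e e' := in_idealAP P (e ++ fscale (-1) e').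

Lemma feval_eqA T e e' : feval T (e ++ fscale (-1) e') = feval T e - feval T e'.
Proof. by rewrite feval_cat feval_scale mulN1r. Qed.

Lemma eqA_ext e e' : (forall T, feval T e = feval T e') -> eqA e e'.
Proof.
by move=> h; apply: ideal_ext ideal0 => T; rewrite feval_eqA h subrr /feval big_nil.
Qed.

Lemma eqA_refl e : eqA e e. Proof. exact: eqA_ext. Qed.

Lemma eqA_trans e1 e2 e3 : eqA e1 e2 -> eqA e2 e3 -> eqA e1 e3.
Proof.
move=> h1 h2; apply: ideal_ext (ideal_cat h1 h2) => T.
by rewrite feval_cat !feval_eqA; ring.
Qed.

Lemma eqA_sym e1 e2 : eqA e1 e2 -> eqA e2 e1.
Proof.
move=> /(ideal_scale (-1)); apply: ideal_ext => T.
by rewrite feval_scale !feval_eqA; ring.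
Qed.

Lemma eqA_cat e1 e2 d1 d2 : eqA e1 e2 -> eqA d1 d2 -> eqA (e1 ++ d1) (e2 ++ d2).
Proof.
move=> h1 h2; apply: ideal_ext (ideal_cat h1 h2) => T.
by rewrite feval_cat !feval_eqA !feval_cat; ring.
Qed.

Lemma eqA_scale c e1 e2 : eqA e1 e2 -> eqA (fscale c e1) (fscale c e2).
Proof.
move=> /(ideal_scale c); apply: ideal_ext => T.
by rewrite feval_scale !feval_eqA !feval_scale; ring.
Qed.

Lemma eqA_mull d e1 e2 : eqA e1 e2 -> eqA (fmul d e1) (fmul d e2).
Proof.
move=> /(ideal_mull d); apply: ideal_ext => T.
rewrite feval_eqA !feval_mul /feval -sumrB; apply: eq_bigr => x _.
rewrite -mulrBr; congr (_ * _).
exact: (feval_eqA (fun y => T (x.2 ++ y))).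
Qed.

Lemma eqA_mulr d e1 e2 : eqA e1 e2 -> eqA (fmul e1 d) (fmul e2 d).
Proof.
move=> /(ideal_mulr d); apply: ideal_ext => T.
by rewrite feval_eqA !feval_mul feval_eqA.
Qed.

Lemma eqA_ideal e : eqA e [::] -> in_idealAP P e.
Proof. by apply: ideal_ext => T; rewrite feval_eqA /feval big_nil subr0. Qed.

Lemma fmulA_eqA e1 e2 e3 : eqA (fmul (fmul e1 e2) e3) (fmul e1 (fmul e2 e3)).
Proof.
apply: eqA_ext => T; rewrite !feval_mul.
apply: eq_bigr => x _; congr (_ * _); rewrite feval_mul.
by apply: eq_bigr => y _; congr (_ * _); apply: eq_bigr => z _; rewrite catA.
Qed.

End Ideal.
End Words.

(** * The symbol of a word and normal forms *)

Section Symbol.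
Variable R : realType.
Local Notation C := (R[i]).
Local Notation felem := (felem R).
Local Notation functional := (functional R).
Implicit Types (a b e r : felem) (T : functional) (p q f : {poly C}).

Lemma gdeg_cat w1 w2 : gdeg (w1 ++ w2) = gdeg w1 + gdeg w2.
Proof. by rewrite /gdeg !count_cat !PoszD; ring. Qed.

Lemma gdeg_cons x w : gdeg (x :: w) = gdeg [:: x] + gdeg w.
Proof. exact: (gdeg_cat [:: x]). Qed.

Lemma gdeg_nseq n x : gdeg (nseq n x) = gdeg [:: x] * n%:Z.
Proof. by elim: n => [|n IH] /=; rewrite ?mulr0 // gdeg_cons IH intS mulrDr mulr1. Qed.

Lemma gdeg_nseq_z n : gdeg (nseq n gz) = 0.
Proof. by rewrite gdeg_nseq mul0r. Qed.

Lemma letterP (Q : 'I_3 -> Prop) : Q gu -> Q gv -> Q gz -> forall x, Q x.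
Proof.
move=> hu hv hz [[|[|[|m]]] hm] //.
- by rewrite (_ : Ordinal hm = gu) //; apply: val_inj.
- by rewrite (_ : Ordinal hm = gv) //; apply: val_inj.
- by rewrite (_ : Ordinal hm = gz) //; apply: val_inj.
Qed.

Lemma feval_poly_lin T : lin (fun q => feval T (fpoly q)).
Proof. by move=> c p q; rewrite feval_polyD. Qed.

Lemma lin_ext (tau sigma : {poly C} -> C) : lin tau -> lin sigma ->
  (forall k, tau 'X^k = sigma 'X^k) -> forall q, tau q = sigma q.
Proof.
move=> tl sl h q; rewrite (lin_coef tl) (lin_coef sl).
by apply: eq_bigr => k _; rewrite h.
Qed.

Lemma feval_polyXn T k : feval T (fpoly 'X^k) = T (nseq k gz).
Proof.
rewrite feval_poly size_polyXn (bigD1 ord_max) //= coefXn eqxx mul1r.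
rewrite big1 ?addr0 // => i ine; rewrite coefXn.
have /negPf -> : nat_of_ord i != k by apply: contra ine => /eqP e; apply/eqP/val_inj.
by rewrite mul0r.
Qed.

Lemma feval_polyC T (c : C) : feval T (fpoly c%:P) = c * T [::].
Proof.
by rewrite -[c%:P]mulr1 mul_polyC (linZ (feval_poly_lin T)) -(expr0 'X) feval_polyXn.
Qed.

Lemma feval_polyM T p q :
  feval T (fpoly (p * q)) = feval T (fmul (fpoly p) (fpoly q)).
Proof.
rewrite feval_mul; move: p.
apply: lin_ext => [c p p'||k]; first by rewrite mulrDl -scalerAl feval_polyD.
  exact: feval_poly_lin.
rewrite feval_polyXn; move: q; apply: lin_ext => [c p p'||j].
- by rewrite mulrDr -scalerAr feval_polyD.
- exact: feval_poly_lin.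
by rewrite -exprD !feval_polyXn nseqD.
Qed.

Variable P : {poly C}.

(* In the skew Laurent ring a word [w] becomes [word_symbol w * x^(- gdeg w)]. *)
Definition letter_symbol (x : 'I_3) : {poly C} :=
  if x == gu then 1 else if x == gv then shiftp 2^-1 P else 'X.

Fixpoint word_symbol (w : word) : {poly C} :=
  if w is x :: w' then letter_symbol x * shiftp (gdeg [:: x])%:~R (word_symbol w') else 1.

Lemma letter_symbolE : (letter_symbol gu = 1) *
  (letter_symbol gv = shiftp 2^-1 P) * (letter_symbol gz = 'X).
Proof. by []. Qed.

Lemma gdegE : ((gdeg [:: gu])%:~R = -1 :> C) * ((gdeg [:: gv])%:~R = 1 :> C) *
  ((gdeg [:: gz])%:~R = 0 :> C).
Proof. by rewrite mulrN1z. Qed.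

Lemma word_symbol_cat w1 w2 :
  word_symbol (w1 ++ w2) = word_symbol w1 * shiftp (gdeg w1)%:~R (word_symbol w2).
Proof.
elim: w1 => [|x w IH] /=; first by rewrite mul1r (_ : gdeg [::] = 0) // mulr0z shiftp0.
by rewrite IH shiftpM shiftp_shiftp (gdeg_cons x w) intrD mulrA.
Qed.

Lemma word_symbol_nseq_z n : word_symbol (nseq n gz) = 'X^n.
Proof. by elim: n => //= n ->; rewrite shiftp0 exprS. Qed.

Lemma word_symbol_neq0 w : P != 0 -> word_symbol w != 0.
Proof.
move=> P0; elim: w => [|x w IH] /=; first exact: oner_neq0.
rewrite mulf_neq0 ?shiftp_eq0 // /letter_symbol; case: ifP => _; first exact: oner_neq0.
by case: ifP => _; rewrite ?shiftp_eq0 // polyX_eq0.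
Qed.

(** [symbol n e] is the coefficient of [x^(-n)] in the image of [e] in the skew Laurent ring;
    [functional_of n tau] applies [tau] to that coefficient. *)
Definition word_symbol_part (n : int) w := if gdeg w == n then word_symbol w else 0.
Definition symbol n e := \sum_(x <- e) x.1 *: word_symbol_part n x.2.
Definition functional_of n (tau : {poly C} -> C) : functional :=
  fun w => tau (word_symbol_part n w).

Lemma feval_functional_of n tau e : lin tau ->
  feval (functional_of n tau) e = tau (symbol n e).
Proof.
move=> tl; rewrite /symbol (lin_sum tl); apply: eq_bigr => x _.
by rewrite (linZ tl).
Qed.

(** Through [feval_functional_of], coefficient functionals turn equalities of symbols into
    equalities of evaluations. *)
Lemma coef_lin k : lin (fun q : {poly C} => q`_k).
Proof. by move=> c p q; rewrite coefD coefZ. Qed.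

Lemma symbol_ext n e e' : (forall T, feval T e = feval T e') -> symbol n e = symbol n e'.
Proof.
move=> h; apply/polyP => k.
by rewrite -!(feval_functional_of _ _ (coef_lin k)).
Qed.

Lemma symbol_poly_word n q w :
  symbol n (fmul (fpoly q) (fword R w)) = if gdeg w == n then q * word_symbol w else 0.
Proof.
apply/polyP => k; rewrite -(feval_functional_of _ _ (coef_lin k)) feval_mul.
move: q; apply: lin_ext.
- exact: feval_poly_lin.
- move=> c p q; case: eqP => _; rewrite ?coef0 ?mulr0 ?addr0 //.
  by rewrite mulrDl -scalerAl coefD coefZ.
move=> j; rewrite feval_polyXn feval_word /functional_of /word_symbol_part.
rewrite gdeg_cat gdeg_nseq_z add0r.
by rewrite word_symbol_cat gdeg_nseq_z shiftp0 word_symbol_nseq_z; case: eqP => _.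
Qed.

(** This is what makes the map to the skew Laurent ring well defined on the quotient and graded by
    [gdeg]: the four relations have weights -1, 1, 0, 0. *)
Lemma relsAP_homog r : r \in relsAP P ->
  exists g : int, (forall x, x \in r -> gdeg x.2 = g) /\
    \sum_(x <- r) x.1 *: word_symbol x.2 = 0.
Proof.
have fp (q : {poly C}) : \sum_(x <- fscale (-1) (fpoly q)) x.1 *: word_symbol x.2 = - q.
  rewrite big_map /fpoly big_map -[X in iota _ X]subn0 big_mkord.
  rewrite -[in RHS](coefK q) poly_def -sumrN; apply: eq_bigr => i _ /=.
  by rewrite word_symbol_nseq_z mulN1r scaleNr.
have fd (q : {poly C}) x : x \in fscale (-1) (fpoly q) -> gdeg x.2 = 0.
  by move=> /mapP[y /mapP[k _ ->] ->] /=; rewrite gdeg_nseq_z.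
rewrite !inE => /or4P[] /eqP ->.
- exists (-1); split=> [x|]; first by rewrite !inE => /or3P[] /eqP ->.
  rewrite !big_cons big_nil /= !shiftp1 !letter_symbolE !gdegE !mulr1 !mul1r shiftp1.
  by rewrite shiftpX !scaleN1r scale1r polyCN; ring.
- exists 1; split=> [x|]; first by rewrite !inE => /or3P[] /eqP ->.
  rewrite !big_cons big_nil /= !shiftp1 !mulr1 !letter_symbolE !gdegE shiftp0 shiftpX.
  by rewrite !scaleN1r !scale1r; ring.
- exists 0; split=> [x|]; first by rewrite inE => /predU1P[->|/fd].
  rewrite big_cons fp /= !letter_symbolE !gdegE !shiftp1 mul1r mulr1 scale1r shiftp_shiftp.
  rewrite -[-1 + _](_ : - 2^-1 = _); last by field.
  by rewrite /shiftp polyCN subrr.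
- exists 0; split=> [x|]; first by rewrite inE => /predU1P[->|/fd].
  rewrite big_cons fp /= !letter_symbolE !gdegE !shiftp1 !mulr1 scale1r.
  by rewrite shiftp1 mulr1 /shiftp subrr.
Qed.

Lemma functional_of_vanishes n tau : lin tau ->
  vanishes_on_ideal P (functional_of n tau).
Proof.
move=> tl w1 w2 r /relsAP_homog[g [hg hr]].
rewrite feval_mul feval_word feval_mul.
transitivity (tau (\sum_(x <- r) x.1 *: word_symbol_part n (w1 ++ x.2 ++ w2))).
  rewrite (lin_sum tl); apply: eq_bigr => x _.
  by rewrite feval_word (linZ tl).
rewrite (_ : \sum_(x <- r) _ = 0) ?(lin0 tl) //.
(* By homogeneity all terms have the same weight, so the symbols of [w1] and [w2] factor out and
   leave the sum [hr]. *)
transitivity (\sum_(x <- r) (if gdeg w1 + g + gdeg w2 == n then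
    word_symbol w1 *
      shiftp (gdeg w1)%:~R ((x.1 *: word_symbol x.2) * shiftp g%:~R (word_symbol w2))
    else 0)).
  apply: eq_big_seq => x /hg h; rewrite /word_symbol_part !gdeg_cat h addrA.
  case: ifP => _; last by rewrite scaler0.
  by rewrite !word_symbol_cat h -scalerAl shiftpZ -scalerAr.
case: (_ == n); last by rewrite big1.
rewrite -mulr_sumr /shiftp -raddf_sum -mulr_suml hr.
by rewrite mul0r raddf0 mulr0.
Qed.

Lemma symbol_ideal n e : in_idealAP P e -> symbol n e = 0.
Proof.
move=> he; apply/polyP => k; rewrite -(feval_functional_of _ _ (coef_lin k)) coef0.
exact: (vanishes_ideal (functional_of_vanishes _ (coef_lin k))).
Qed.

Lemma symbol_eqA n e e' : eqA P e e' -> symbol n e = symbol n e'.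
Proof.
move=> /(symbol_ideal n) /polyP h; apply/polyP => k; apply/eqP.
rewrite -subr_eq0 -!(feval_functional_of _ _ (coef_lin k)) -feval_eqA.
by rewrite (feval_functional_of _ _ (coef_lin k)) h coef0.
Qed.

(** The powers of [v] and of [u] form a basis of the algebra as a left module over the polynomials
    in [z], one in each weight. *)
Definition base (n : int) : word :=
  match n with Posz m => nseq m gv | Negz m => nseq m.+1 gu end.

Lemma gdeg_base n : gdeg (base n) = n.
Proof. by case: n => n; rewrite /base gdeg_nseq; [exact: mul1r | rewrite NegzE -mulN1r]. Qed.

Definition nf n q := fmul (fpoly q) (fword R (base n)).

Lemma eqA_rel (w : word) (e r : felem) : r \in relsAP P ->
  (forall T, feval T r = T w - feval T e) -> eqA P (fword R w) e.
Proof.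
move=> /ideal_rel hr h; apply: ideal_ext hr => T.
by rewrite feval_eqA feval_word h.
Qed.

Lemma feval_XaddC_word T (c : C) w :
  feval T (fmul (fpoly ('X + c%:P)) (fword R w)) = T (gz :: w) + c * T w.
Proof.
rewrite feval_mul -['X]scale1r feval_polyD mul1r feval_polyC -['X]expr1.
by rewrite feval_polyXn !feval_word.
Qed.

Lemma eqA_uz : eqA P (fword R [:: gu; gz])
  (fmul (fpoly ('X + (gdeg [:: gu])%:~R%:P)) (fword R [:: gu])).
Proof.
apply: eqA_sym; apply: ideal_ext (ideal_rel (mem_head _ _)) => T.
by rewrite feval_eqA feval_XaddC_word feval_word /feval !big_cons big_nil /= gdegE; ring.
Qed.

Lemma eqA_vz : eqA P (fword R [:: gv; gz])
  (fmul (fpoly ('X + (gdeg [:: gv])%:~R%:P)) (fword R [:: gv])).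
Proof.
apply: eqA_sym.
have h : nth [::] (relsAP P) 1 \in relsAP P by rewrite mem_nth.
apply: ideal_ext (ideal_rel h) => T.
by rewrite feval_eqA feval_XaddC_word feval_word /feval !big_cons big_nil /= gdegE; ring.
Qed.

Lemma eqA_uv : exists q, eqA P (fword R [:: gu; gv]) (fpoly q).
Proof.
exists (P \Po ('X - (2^-1)%:P)).
have h : nth [::] (relsAP P) 2 \in relsAP P by rewrite mem_nth.
apply: (eqA_rel h) => T.
by rewrite -feval_word -mulN1r -feval_scale -feval_cat.
Qed.

Lemma eqA_vu : exists q, eqA P (fword R [:: gv; gu]) (fpoly q).
Proof.
exists (P \Po ('X + (2^-1)%:P)).
have h : nth [::] (relsAP P) 3 \in relsAP P by rewrite mem_nth.
apply: (eqA_rel h) => T.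
by rewrite -feval_word -mulN1r -feval_scale -feval_cat.
Qed.

(** Commuting a letter past [z] shifts [z] by [c]; Horner induction on [q] extends this to
    polynomials. *)
Lemma eqA_letter_poly x (c : C) q :
  eqA P (fword R [:: x; gz]) (fmul (fpoly ('X + c%:P)) (fword R [:: x])) ->
  eqA P (fmul (fword R [:: x]) (fpoly q)) (fmul (fpoly (shiftp c q)) (fword R [:: x])).
Proof.
move=> h.
have {}h : eqA P (fmul (fword R [:: x]) (fword R [:: gz]))
    (fmul (fpoly ('X + c%:P)) (fword R [:: x])).
  by apply: eqA_trans (eqA_ext _ _) h => T; rewrite feval_mul !feval_word.
elim/poly_ind: q => [|q a IH].
  apply: eqA_ext => T; rewrite feval_mul feval_word feval_mul.
  by rewrite /shiftp comp_poly0 !feval_poly size_poly0 !big_ord0.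
apply: (@eqA_trans _ _ _ (fmul (fmul (fword R [:: x]) (fpoly q)) (fword R [:: gz]) ++
   fscale a (fword R [:: x]))).
  apply: eqA_ext => T; rewrite feval_cat feval_scale !feval_mul !feval_word.
  rewrite -[q * 'X]scale1r feval_polyD feval_polyC feval_polyM mul1r !feval_mul.
  congr (_ + _); apply: eq_bigr => y _; congr (_ * _).
  by rewrite -['X]expr1 feval_polyXn feval_word.
apply: eqA_trans (eqA_cat (eqA_mulr _ IH) (eqA_refl _ _)) _.
apply: eqA_trans (eqA_cat (fmulA_eqA _ _ _ _) (eqA_refl _ _)) _.
apply: eqA_trans (eqA_cat (eqA_mull _ h) (eqA_refl _ _)) _.
apply: eqA_ext => T; rewrite shiftpD shiftpM shiftpX shiftpC.
rewrite feval_cat feval_scale !feval_mul feval_word.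
rewrite -[_ * ('X + _)]scale1r feval_polyD feval_polyC mul1r feval_word.
rewrite feval_polyM feval_mul; congr (_ + _).
apply: eq_bigr => y _; congr (_ * _); rewrite feval_mul.
by apply: eq_bigr => z _; congr (_ * _); rewrite !feval_word catA.
Qed.

Lemma eqA_letter x q : exists q',
  eqA P (fmul (fword R [:: x]) (fpoly q)) (fmul (fpoly q') (fword R [:: x])).
Proof.
elim/letterP: x.
- by exists (shiftp (gdeg [:: gu])%:~R q); apply/eqA_letter_poly/eqA_uz.
- by exists (shiftp (gdeg [:: gv])%:~R q); apply/eqA_letter_poly/eqA_vz.
exists (shiftp 0 q); apply/eqA_letter_poly/eqA_ext => T.
by rewrite feval_XaddC_word feval_word mul0r addr0.
Qed.

Lemma eqA_letter_nf x n q : exists q',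
  eqA P (fmul (fword R [:: x]) (nf n q)) (fmul (fpoly q') (fword R (x :: base n))).
Proof.
have [q' h] := eqA_letter x q; exists q'.
apply: eqA_trans (eqA_sym (fmulA_eqA _ _ _ _)) _.
apply: eqA_trans (eqA_mulr _ h) _.
apply: eqA_ext => T; rewrite !feval_mul; apply: eq_bigr => y _; congr (_ * _).
by rewrite !feval_word -catA.
Qed.

Lemma eqA_contract x y w q : (exists q0, eqA P (fword R [:: x; y]) (fpoly q0)) ->
  exists q', eqA P (fmul (fpoly q) (fword R [:: x, y & w])) (fmul (fpoly q') (fword R w)).
Proof.
move=> [q0 h]; exists (q * q0).
apply: (@eqA_trans _ _ _ (fmul (fmul (fpoly q) (fword R [:: x; y])) (fword R w))).
  apply: eqA_ext => T; rewrite !feval_mul; apply: eq_bigr => z _; congr (_ * _).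
  by rewrite !feval_word -catA.
apply: eqA_trans (eqA_mulr _ (eqA_mull _ h)) _.
apply: eqA_ext => T; rewrite feval_mul [RHS]feval_mul feval_polyM //.
Qed.

(** Letters are multiplied on the left one at a time. After the polynomial is moved in front of the
    letter, [u] or [v] either lengthens the power in [base] or cancels against an opposite letter,
    and [z] is absorbed into the polynomial. *)
Lemma normal_form w : exists q, eqA P (fword R w) (nf (gdeg w) q).
Proof.
elim: w => [|x w [q IH]].
  exists 1; apply: eqA_ext => T.
  by rewrite /nf feval_mul -[X in fpoly X](expr0 'X) feval_polyXn !feval_word.
have h1 : eqA P (fword R (x :: w)) (fmul (fword R [:: x]) (nf (gdeg w) q)).
  apply: eqA_trans _ (eqA_mull _ IH); apply: eqA_ext => T.
  by rewrite feval_mul !feval_word.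
have [q1 h2] := eqA_letter_nf x (gdeg w) q.
suff [q2 h3] : exists q2, eqA P (fmul (fpoly q1) (fword R (x :: base (gdeg w))))
    (nf (gdeg (x :: w)) q2).
  by exists q2; apply: eqA_trans h1 (eqA_trans h2 h3).
rewrite gdeg_cons; move: (gdeg w) => n {h1 h2 IH}.
have gu1 : gdeg [:: gu] = -1 by [].
have gv1 : gdeg [:: gv] = 1 by [].
have gz0 : gdeg [:: gz] = 0 by [].
elim/letterP: x; rewrite ?gu1 ?gv1 ?gz0.
- case: n => [[|m]|m].
  + by exists q1; apply: eqA_refl.
  + have [q2 h] := eqA_contract (nseq m gv) q1 eqA_uv; exists q2.
    have -> : -1 + m.+1%:Z = m by lia.
    exact: h.
  exists q1; have -> : -1 + Negz m = Negz m.+1 by lia.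
  exact: eqA_refl.
- case: n => m.
    exists q1; have -> : 1 + m%:Z = m.+1 by lia.
    exact: eqA_refl.
  have [q2 h] := eqA_contract (nseq m gu) q1 eqA_vu; exists q2.
  have -> : 1 + Negz m = - m%:Z by lia.
  by case: m h => [|m].
exists (q1 * 'X); rewrite add0r; apply: eqA_ext => T.
rewrite /nf !feval_mul feval_polyM feval_mul; apply: eq_bigr => y _; congr (_ * _).
by rewrite -['X]expr1 feval_polyXn !feval_word -catA.
Qed.

(** This is injectivity of the embedding. The weight [n] part of [e] is congruent to [nf n q] for
    some [q], and its symbol is [q] times the symbol of [base n], which is nonzero; hence
    [q = 0]. *)
Lemma symbol_eq0_ideal e : P != 0 -> (forall n, symbol n e = 0) -> in_idealAP P e.
Proof.
move=> P0 h; have [Q hQ] := choice normal_form.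
have sQ w : word_symbol w = Q w * word_symbol (base (gdeg w)).
  have := symbol_eqA (gdeg w) (hQ w); rewrite symbol_poly_word gdeg_base eqxx => <-.
  by rewrite /symbol big_seq1 scale1r /word_symbol_part eqxx.
apply: eqA_ideal.
apply: (@eqA_trans _ _ _ (flatten [seq fscale x.1 (nf (gdeg x.2) (Q x.2)) | x <- e])).
  elim: (e) => [|[c w] e' IH] /=; first exact: eqA_refl.
  apply: (@eqA_trans _ _ _ (fscale c (fword R w) ++ e')).
    apply: eqA_ext => T; rewrite feval_cat feval_scale feval_word /feval.
    by rewrite big_cons.
  by apply: eqA_cat => //; apply: eqA_scale.
apply: eqA_ext => T; rewrite [RHS]/feval big_nil feval_flatten big_map.
rewrite (big_fiber (g := fun x => gdeg x.2) _ (undup_uniq [seq gdeg x.2 | x <- e]));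
  last first.
  by move=> n; rewrite mem_undup.
rewrite big1 // => n _.
have Gl : lin (fun q => feval T (nf n q)).
  by move=> c p q; rewrite /nf !feval_mul feval_polyD.
transitivity (feval T (nf n (\sum_(x <- e | gdeg x.2 == n) x.1 *: Q x.2))).
  rewrite (lin_sum Gl); apply: eq_bigr => x /eqP e1.
  by rewrite feval_scale e1 (linZ Gl).
rewrite (_ : \sum_(_ <- _ | _) _ = 0); first exact: (lin0 Gl).
have /eqP := h n; rewrite /symbol.
rewrite (_ : \sum_(_ <- _) _ =
    (\sum_(x <- e | gdeg x.2 == n) x.1 *: Q x.2) * word_symbol (base n)).
  by rewrite mulf_eq0 (negPf (word_symbol_neq0 _ P0)) orbF => /eqP.
rewrite mulr_suml [RHS]big_mkcond; apply: eq_bigr => x _; rewrite /word_symbol_part.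
by case: eqP => [<-|_]; rewrite ?scaler0 // sQ scalerAl.
Qed.

End Symbol.

(** * Twisted traces as functionals on polynomials *)

Section Traces.
Variable R : realType.
Local Notation C := (R[i]).
Local Notation felem := (felem R).
Local Notation functional := (functional R).
Variables (P : {poly C}) (t : C).
Hypotheses (P_neq0 : P != 0) (t_neq0 : t != 0).
Implicit Types (e : felem) (T : functional) (p q f : {poly C}) (tau : {poly C} -> C).

Local Notation phi := (symbol P).
Local Notation symb := (word_symbol P).
Local Notation trace_of := (functional_of P 0).

Lemma symbol_cat n e e' : phi n (e ++ e') = phi n e + phi n e'.
Proof. by rewrite /symbol big_cat. Qed.

Lemma symbol_scale n c e : phi n (fscale c e) = c *: phi n e.
Proof.
by rewrite /symbol big_map scaler_sumr; apply: eq_bigr => x _; rewrite scalerA.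
Qed.

Lemma symbol_word n w : phi n (fword R w) = word_symbol_part P n w.
Proof. by rewrite /symbol big_seq1 scale1r. Qed.

Lemma symbol_poly n q : phi n (fpoly q) = if n == 0 then q else 0.
Proof.
transitivity (phi n (fmul (fpoly q) (fword R [::]))).
  apply: symbol_ext => T; rewrite feval_mul; apply: eq_bigr => x _.
  by rewrite feval_word cats0.
by rewrite symbol_poly_word /= mulr1 eq_sym.
Qed.

Lemma symbol_inj e e' : (forall n, phi n e = phi n e') -> eqA P e e'.
Proof.
move=> h; apply: symbol_eq0_ideal => // n.
by rewrite symbol_cat symbol_scale h scaleN1r subrr.
Qed.

Lemma vanishes_eqA T e e' : vanishes_on_ideal P T -> eqA P e e' -> feval T e = feval T e'.
Proof.
by move=> hT /(vanishes_ideal hT)/eqP; rewrite feval_eqA subr_eq0 => /eqP.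
Qed.

Lemma word_symbol_divides_base w : exists q, symb w = q * symb (base (gdeg w)).
Proof.
have [q h] := normal_form P w; exists q.
have := symbol_eqA (gdeg w) h; rewrite symbol_poly_word gdeg_base eqxx => <-.
by rewrite symbol_word /word_symbol_part eqxx.
Qed.

(** The commutator of [z] and [w] is [- gdeg w] times [w], and [T] kills it because [g_t] fixes
    [z]. *)
Lemma trace_weight_neq0 T w : twisted_trace P t T -> gdeg w != 0 -> T w = 0.
Proof.
move=> [hT tr] gw.
have h : eqA P (fword R (gz :: w))
    (fword R (w ++ [:: gz]) ++ fscale (- (gdeg w)%:~R) (fword R w)).
  apply: symbol_inj => n; rewrite symbol_cat symbol_scale !symbol_word /word_symbol_part.
  rewrite gdeg_cat gdeg_cons (_ : gdeg [:: gz] = 0) // add0r addr0.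
  case: eqP => _; last by rewrite scaler0 addr0.
  rewrite word_symbol_cat /= shiftp0 /letter_symbol /= shiftp0 mulr1 shiftpX -mul_polyC polyCN.
  ring.
have := vanishes_eqA hT h; rewrite feval_cat feval_scale !feval_word.
rewrite (tr w [:: gz]) expr0z mul1r -[LHS]addr0 => /addrI /esym/eqP.
by rewrite mulf_eq0 oppr_eq0 intr_eq0 (negPf gw) => /eqP.
Qed.

Lemma trace_functional T : twisted_trace P t T -> exists tau,
  [/\ lin tau, T = trace_of tau & forall s, tau (tdiff t (P * s)) = 0].
Proof.
move=> hT; have tl := feval_poly_lin T; set tau := fun q => _ in tl.
have hw w : T w = trace_of tau w.
  rewrite /functional_of /word_symbol_part; case: eqP => [gw|/eqP gw]; last first.
    by rewrite (lin0 tl) (trace_weight_neq0 hT gw).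
  rewrite -feval_word; apply: (vanishes_eqA (proj1 hT)); apply: symbol_inj => n.
  by rewrite symbol_word symbol_poly /word_symbol_part gw eq_sym.
exists tau; split=> [//||s]; first exact/funext.
(* This is the trace identity for the pair [u], [z^k v], extended linearly from [z^k] to [r]. *)
have E r : tau (shiftp (-1) r * shiftp (- 2^-1) P) = t * tau (r * shiftp 2^-1 P).
  move: r; apply: lin_ext.
  - by move=> c p q; rewrite shiftpD shiftpZ mulrDl -scalerAl tl.
  - by move=> c p q; rewrite mulrDl -scalerAl tl; ring.
  move=> k; have := proj2 hT [:: gu] (nseq k gz ++ [:: gv]).
  rewrite !hw /functional_of /word_symbol_part !gdeg_cat gdeg_nseq_z.
  rewrite (_ : gdeg [:: gu] = -1) // (_ : gdeg [:: gv] = 1) // add0r addNr subrr eqxx.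
  rewrite expr1z !word_symbol_cat gdeg_cat gdeg_nseq_z word_symbol_nseq_z shiftp0 /=.
  rewrite !letter_symbolE !gdegE !shiftp1 !mulr1 mul1r shiftpM shiftp_shiftp.
  have -> : -1 + 2^-1 = - 2^-1 :> C by field.
  by rewrite shiftp1 mulr1.
have := E (shiftp 2^-1 s); rewrite shiftp_shiftp.
have -> : -1 + 2^-1 = - 2^-1 :> C by field.
rewrite /tdiff !shiftpM (linB tl) (linZ tl) ![shiftp _ s * _]mulrC => ->.
by rewrite subrr.
Qed.

Lemma functional_trace tau : lin tau -> (forall s, tau (tdiff t (P * s)) = 0) ->
  twisted_trace P t (trace_of tau).
Proof.
move=> tl h; split; first exact: functional_of_vanishes.
have E s : tau (shiftp (- 2^-1) (P * s)) = t * tau (shiftp 2^-1 (P * s)).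
  by apply/eqP; rewrite -subr_eq0 -(linZ tl) -(linB tl) -/(tdiff t _) h.
(* It suffices to carry one letter from the front to the back. For [u], the word [w] has weight 1,
   so its symbol contains the factor [shiftp 2^-1 P] that [E] requires; for [v], the letter itself
   supplies it. *)
have hl x w : trace_of tau (x :: w) = t ^ gdeg w * trace_of tau (w ++ [:: x]).
  rewrite /functional_of /word_symbol_part gdeg_cat gdeg_cons [gdeg w + _]addrC.
  case: eqP => [gw|_]; last by rewrite (lin0 tl) mulr0.
  rewrite word_symbol_cat; have [q hq] := word_symbol_divides_base w; move: gw hq.
  elim/letterP: x => [gw|gw|].
  - have -> : gdeg w = 1 by move: gw; rewrite (_ : gdeg [:: gu] = -1) //; lia.
    rewrite expr1z /= !letter_symbolE !gdegE !shiftp1 !mulr1 mul1r => ->.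
    have := E (shiftp (- 2^-1) q); rewrite !shiftpM !shiftp_shiftp addrN shiftp0.
    rewrite -opprD half_half shiftp1 mulr1 [_ * q]mulrC => <-.
    have -> : -1 + 2^-1 = - 2^-1 :> C by field.
    by rewrite [in RHS]mulrC.
  - have -> : gdeg w = -1 by move: gw; rewrite (_ : gdeg [:: gv] = 1) //; lia.
    rewrite /= !letter_symbolE !gdegE !shiftp1 !mulr1 shiftp_shiftp => _.
    have := E (shiftp 2^-1 (symb w)); rewrite !shiftpM !shiftp_shiftp addNr shiftp0.
    rewrite half_half.
    have -> : -1 + 2^-1 = - 2^-1 :> C by field.
    rewrite [symb w * _]mulrC => ->.
    by rewrite exprN1 mulKf.
  rewrite (_ : gdeg [:: gz] = 0) // add0r => -> _ /=.
  by rewrite !letter_symbolE !shiftp0 mulr1 mul1r mulrC.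
move=> w1 w2; elim: w1 w2 => [|x w1 IH] w2.
  rewrite cats0 /= /functional_of /word_symbol_part.
  by case: eqP => [->|_]; rewrite ?(lin0 tl) ?mulr0 // expr0z mul1r.
rewrite cat_cons hl -catA IH mulrA -expfzDr //.
rewrite -catA /= gdeg_cat [gdeg (_ ++ _)]gdeg_cat.
(* The accumulated exponent is [gdeg w2] plus the total weight. It is correct in weight 0, and in
   any other weight both sides vanish. *)
have [g0|g1] := eqVneq (gdeg w2 + gdeg (x :: w1)) 0.
  congr (t ^ _ * _); move: g0; rewrite gdeg_cons; lia.
rewrite /functional_of /word_symbol_part gdeg_cat (negPf g1).
by rewrite (lin0 tl) !mulr0.
Qed.

Lemma degenerate_fsupp tau : lin tau ->
  degenerate P (trace_of tau) <-> fsupp tau.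
Proof.
move=> tl; split=> [[a [na ha]]|[f f0 hf]]; last first.
  exists (fpoly f); split=> [/(symbol_ideal 0)|w].
    by rewrite symbol_poly eqxx => /eqP; rewrite (negPf f0).
  rewrite (feval_functional_of _ _ _ tl) symbol_poly_word.
  by case: ifP => _; rewrite ?hf ?(lin0 tl).
have [n an] : exists n, phi n a != 0.
  apply: contrapT => hn; apply: na; apply: symbol_eq0_ideal => // n.
  by apply/eqP/negPn/negP => h; apply: hn; exists n.
(* Multiplying [a] on the right by [base (- n)] and [z^k] brings exactly its weight [n] part to
   weight 0, giving this polynomial times ['X^k]. *)
exists (phi n a * shiftp n%:~R (symb (base (- n)))).
  by rewrite mulf_neq0 // shiftp_eq0 word_symbol_neq0.
apply: (lin_mulr_eq0 tl) => k.
rewrite -[RHS](ha (base (- n) ++ nseq k gz)) (feval_functional_of _ _ _ tl); congr tau.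
rewrite /symbol !mulr_suml big_allpairs_dep /=; apply: eq_bigr => x _.
rewrite big_seq1 /= mulr1 /word_symbol_part gdeg_cat [gdeg (base _ ++ _)]gdeg_cat.
rewrite gdeg_base gdeg_nseq_z addr0.
rewrite subr_eq0; case: eqP => [e|_]; last by rewrite !scaler0 !mul0r.
rewrite !word_symbol_cat e gdeg_base word_symbol_nseq_z.
rewrite shiftpM shiftp_shiftp mulrNz addrN shiftp0.
by rewrite -!scalerAl mulrA.
Qed.

End Traces.

(** * Splitting off one root per coset *)

Section ClassRepresentatives.
Variables (T : eqType) (E : rel T).
Hypotheses (E_refl : reflexive E) (E_sym : symmetric E) (E_trans : transitive E).
Local Open Scope nat_scope.
Implicit Types (s : seq T) (a b : T).

(** [coset_first] with the relation abstracted, so that [deltaP] has the shape of the sum in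
    [sum_excess]. *)
Definition class_first s a := all (fun b => ~~ E a b) (take (index a s) s).

Lemma class_first_index s a b : class_first s a -> b \in s -> E a b ->
  index a s <= index b s.
Proof.
move=> /allP h bs ab; rewrite leqNgt; apply/negP => hlt.
by have := h b; rewrite in_take // hlt ab => /(_ isT).
Qed.

Lemma class_first_uniq s a b : a \in s -> b \in s ->
  class_first s a -> class_first s b -> E a b -> a = b.
Proof.
move=> as_ bs ha hb ab; rewrite -(nth_index a as_) -[RHS](nth_index a bs); congr nth.
apply/eqP; rewrite eqn_leq (class_first_index ha bs ab).
by rewrite (class_first_index hb as_) // E_sym.
Qed.

Lemma class_first_exists s b : b \in s ->
  exists a, [/\ a \in s, class_first s a & E a b].
Proof.
move=> bs; have hb : has (E b) s by apply/hasP; exists b.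
pose a := nth b s (find (E b) s).
have ba : E b a by exact: nth_find.
have as_ : a \in s by rewrite mem_nth // -has_find.
exists a; split; rewrite // 1?E_sym //; apply/allP => c hc.
have cs := mem_take hc; rewrite in_take // in hc.
apply/negP => ac; have ia : index a s <= find (E b) s.
  by rewrite index_nth // -has_find.
have := before_find b (a := E b) (leq_trans hc ia).
by rewrite nth_index // (E_trans ba ac).
Qed.

Lemma sum_classes s (F : T -> nat) : uniq s ->
  \sum_(b <- s) F b = \sum_(a <- s | class_first s a) \sum_(b <- s | E a b) F b.
Proof.
move=> us; rewrite (exchange_big_dep xpredT) //=; apply: eq_big_seq => b bs.
have [a [as_ ha ab]] := class_first_exists bs.
rewrite big_mkcond (bigD1_seq a) //= ha ab big_seq_cond big1 ?addn0 // => c /andP[cs ca].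
case: ifP => // /andP[hc cb]; case/eqP: ca; apply: class_first_uniq hc ha _ => //.
by apply: E_trans cb _; rewrite E_sym.
Qed.

Variable w : T -> nat.

(** Sorting by decreasing weight first makes the representative of each class one of maximal weight,
    with ties broken consistently. *)
Definition heavy_rep s := class_first (sort (fun a b => w b <= w a) s).

Let heavy_total : total (fun a b => w b <= w a).
Proof. by move=> a b; apply: leq_total. Qed.

Lemma heavy_rep_max s a b : a \in s -> b \in s -> heavy_rep s a -> E a b -> w b <= w a.
Proof.
move=> as_ bs ha ab; pose leT a b := w b <= w a.
have tr : transitive leT by move=> y x z hx hy; apply: leq_trans hy hx.
have rf : reflexive leT by move=> x; apply: leqnn.
apply: (sorted_leq_index tr rf (sort_sorted heavy_total s)); rewrite ?mem_sort //.
by apply: class_first_index; rewrite ?mem_sort.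
Qed.

Lemma heavy_rep_exists s b : b \in s -> exists a, [/\ a \in s, heavy_rep s a & E a b].
Proof.
move=> bs; have [|a [as_ ha ab]] := @class_first_exists (sort (fun a b => w b <= w a) s) b.
  by rewrite mem_sort.
by exists a; rewrite mem_sort in as_.
Qed.

Lemma heavy_rep_uniq s a b : a \in s -> b \in s ->
  heavy_rep s a -> heavy_rep s b -> E a b -> a = b.
Proof. by move=> as_ bs; apply: class_first_uniq; rewrite mem_sort. Qed.

(** Within a class the maximum is the weight of the heavy representative, so the difference is the
    total weight of the other members. *)
Lemma sum_excess s : uniq s ->
  \sum_(a <- s | class_first s a)
     (\sum_(b <- s | E a b) w b - \max_(b <- s | E a b) w b)
  = \sum_(b <- s | ~~ heavy_rep s b) w b.
Proof.
move=> us; rewrite [RHS]big_mkcond (sum_classes _ us).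
rewrite big_seq_cond [RHS]big_seq_cond; apply: eq_bigr => a /andP[as_ ha].
have [r [rs hr ra]] := heavy_rep_exists as_.
have ar : E a r by rewrite E_sym.
have -> : \max_(b <- s | E a b) w b = w r.
  apply/eqP; rewrite eqn_leq leq_bigmax_seq // andbT.
  apply/bigmax_leqP_seq => b bs ab; apply: (heavy_rep_max rs bs hr).
  exact: E_trans ra ab.
rewrite [in LHS]big_mkcond (bigD1_seq r) //= ar addKn.
rewrite [RHS]big_mkcond [RHS](bigD1_seq r) //= ar hr add0n.
rewrite big_seq_cond [RHS]big_seq_cond; apply: eq_bigr => b /andP[bs br].
case: ifP => // ab; case: ifP => // /negbFE hb; case/eqP: br.
by apply: heavy_rep_uniq hb hr _ => //; apply: E_trans ar; rewrite E_sym.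
Qed.

End ClassRepresentatives.

Section Splitting.
Variable R : realType.
Local Notation C := (R[i]).
Implicit Types (P M N : {poly C}).

Lemma same_coset_refl : reflexive (@same_coset R).
Proof. by move=> a; apply/asboolP; exists 0; rewrite subrr. Qed.

Lemma same_coset_sym : symmetric (@same_coset R).
Proof.
by move=> a b; apply/asboolP/asboolP => -[n h]; exists (- n); rewrite mulrNz -h opprB.
Qed.

Lemma same_coset_trans : transitive (@same_coset R).
Proof.
move=> b a c /asboolP[n h] /asboolP[m h']; apply/asboolP; exists (n + m).
by rewrite intrD -h -h'; ring.
Qed.

Lemma mem_rootsC P a : P != 0 -> (a \in rootsC P) = root P a.
Proof.
move=> P0; rewrite /rootsC mem_undup; case: closed_field_poly_normal => r /= e.
by rewrite e rootZ ?lead_coef_eq0 // root_prod_XsubC.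
Qed.

Lemma prod_rootsC P : P \is monic ->
  P = \prod_(a <- rootsC P) ('X - a%:P) ^+ mup a P.
Proof.
move=> mP; rewrite /rootsC; case: closed_field_poly_normal => r /= e.
move: e; rewrite (monicP mP) scale1r => e.
rewrite [LHS]e -big_undup_iterop_count; apply: eq_bigr => a _.
by rewrite {1}e mu_prod_XsubC.
Qed.

Lemma size_prod_exp_XsubC (s : seq C) (Q : pred C) (e : C -> nat) :
  size (\prod_(a <- s | Q a) ('X - a%:P) ^+ e a) = (\sum_(a <- s | Q a) e a).+1.
Proof.
elim: s => [|a s IH]; first by rewrite !big_nil size_poly1.
rewrite !big_cons; case: ifP => // _.
rewrite size_monicM ?monic_exp ?monicXsubC //.
  by rewrite IH size_exp_XsubC /= addnS.
by rewrite -size_poly_eq0 IH.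
Qed.

Lemma root_prod_exp_XsubC (s : seq C) (Q : pred C) (e : C -> nat) a :
  root (\prod_(b <- s | Q b) ('X - b%:P) ^+ e b) a -> (a \in s) && Q a.
Proof.
elim: s => [|b s IH]; first by rewrite big_nil (negPf (root1 a)).
rewrite big_cons inE; case: ifP => [Qb|_ /IH /andP[-> ->]]; last by rewrite orbT.
rewrite rootM => /orP[|/IH /andP[-> ->]]; last by rewrite orbT.
rewrite /root hornerE expf_eq0 !hornerE subr_eq0 => /andP[_ /eqP ->].
by rewrite eqxx Qb.
Qed.

(* [M] keeps, in each coset of the integers, one root of [P] of maximal multiplicity. *)
Definition coset_split P M N :=
  [/\ P = M * N, M \is monic,
      forall a (n : nat), root M a -> root M (a + n%:R) -> n = 0%N &
      forall a, root P a -> exists n : int, ('X - (a + n%:~R)%:P) ^+ mup a P %| M].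

Lemma coset_split_exists P : P \is monic ->
  exists M N, coset_split P M N /\ size N = (deltaP P).+1.
Proof.
move=> mP; set s := rootsC P; pose w a := mup a P.
pose rep := heavy_rep (@same_coset R) w s.
have P0 := monic_neq0 mP.
exists (\prod_(a <- s | rep a) ('X - a%:P) ^+ w a).
exists (\prod_(a <- s | ~~ rep a) ('X - a%:P) ^+ w a); split; last first.
  rewrite size_prod_exp_XsubC; congr S; rewrite -sum_excess ?undup_uniq //.
  - exact: same_coset_refl.
  - exact: same_coset_sym.
  - exact: same_coset_trans.
have rM := @root_prod_exp_XsubC s rep w.
split.
- by rewrite {1}(prod_rootsC mP) (bigID rep).
- by apply: monic_prod => a _; rewrite monic_exp // monicXsubC.
- move=> a n /rM /andP[as_ ra] /rM/andP[bs rb].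
  have : a = a + n%:R.
    apply: (heavy_rep_uniq same_coset_sym as_ bs ra rb).
    by apply/asboolP; exists (- n%:Z); rewrite mulrNz opprD addNKr.
  by move/eqP; rewrite -{1}[a]addr0 (inj_eq (addrI a)) eq_sym pnatr_eq0 => /eqP.
- move=> a ra; have as_ : a \in s by rewrite mem_rootsC.
  have [b [bs hb ba]] :=
    heavy_rep_exists same_coset_refl same_coset_sym same_coset_trans w as_.
  have /asboolP[n hn] := ba; exists n; rewrite -hn [a + _]addrC subrK.
  apply: (@dvdp_trans _ (('X - b%:P) ^+ w b)).
    by apply: dvdp_exp2l; exact: (heavy_rep_max bs as_ hb).
  by rewrite big_mkcond (bigD1_seq b) ?undup_uniq //= [rep b]hb dvdp_mulIl.
Qed.

(** * Reading the root pattern of [P] off the degrees of [M] and [N] *)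

Section Consequences.
Variables P M N : {poly C}.
Hypotheses (P_monic : P \is monic) (split : coset_split P M N).

Let M_monic : M \is monic. Proof. by case: split. Qed.
Let P_eq : P = M * N. Proof. by case: split. Qed.
Let M_neq0 : M != 0. Proof. exact: monic_neq0. Qed.
Let P_neq0 : P != 0. Proof. exact: monic_neq0. Qed.
Let N_neq0 : N != 0.
Proof. by apply: contraNneq P_neq0 => h; rewrite P_eq h mulr0. Qed.

Lemma split_monicr : N \is monic.
Proof. by have := P_monic; rewrite P_eq monicMl. Qed.

Lemma split_size : size P = (size M + size N).-1.
Proof. by rewrite P_eq size_monicM. Qed.

Lemma split_root a : root P a -> exists n : int, root M (a + n%:~R) /\
  (mup a P <= mup (a + n%:~R) M)%N.
Proof.
move=> ra; case: split => _ _ _ /(_ a ra) [n h]; exists n.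
have hm : (mup a P <= mup (a + n%:~R) M)%N by rewrite mup_geq.
split => //; rewrite -dvdp_XsubCl XsubC_dvd //; apply: leq_trans hm.
by rewrite -XsubC_dvd // dvdp_XsubCl.
Qed.

Lemma split_sizel : (1 < size P)%N -> (1 < size M)%N.
Proof.
move=> sP; have [|x /split_root[n [rM _]]] := closed_rootP P _.
  by rewrite gtn_eqF.
apply: contraLR rM; rewrite -leqNgt => /size1_polyC e.
move: M_neq0; rewrite {}e polyC_eq0 => c0; by rewrite /root hornerC.
Qed.

Lemma split_trivial : size N = 1%N <->
  forall a b, root P a -> root P b -> a != b -> ~ isZ (a - b).
Proof.
split=> [sN a b ra rb ab [n hn]|h].
  have PM : P = M.
    have /size_poly1P[c c0 e] := introT eqP sN.
    have := split_monicr; rewrite P_eq e monicE lead_coefC => /eqP ->.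
    by rewrite mulr1.
  case: split => _ _ hM _; move: ra rb; rewrite PM => ra rb.
  case/eqP: ab; move/eqP: hn; rewrite subr_eq => /eqP hn.
  case: n hn => n hn.
    have := hM b n rb; rewrite addrC -hn => /(_ ra) n0.
    by rewrite hn n0 add0r.
  have hb : b = a + n.+1%:R by rewrite hn NegzE mulrNz addrAC addNr add0r.
  by have := hM a n.+1 ra; rewrite -hb => /(_ rb).
apply/eqP/negPn/negP => sN; have [c rc] := closed_rootP N sN.
have rP : root P c by rewrite P_eq rootM rc orbT.
(* As distinct roots never differ by an integer, [n = 0]; then [M] alone carries the full
   multiplicity of [c] in [P], leaving none for [N]. *)
have [n [rM hm]] := split_root rP.
have rPn : root P (c + n%:~R) by rewrite P_eq rootM rM.
have e : c + n%:~R = c.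
  apply/eqP/negPn/negP => ne; apply: (h _ _ rPn rP ne).
  by exists n; rewrite addrC addKr.
move: hm; rewrite e P_eq mupM // -{2}[mup c M]addn0 leq_add2l leqn0.
by rewrite -(negbK (_ == _)) -lt0n -XsubC_dvd // dvdp_XsubCl rc.
Qed.

(** All roots of [M] are congruent, hence equal to one [r], so [M] is a power of ['X - r%:P]. Its
    exponent lies between [mup a P] and [mup r P], which is at most [mup a P]. *)
Lemma split_single_coset a : root P a ->
  (forall b, root P b -> isZ (b - a)) ->
  (forall b, root P b -> (mup b P <= mup a P)%N) -> size M = (mup a P).+1.
Proof.
move=> ra hZ hm; have [n [rM hn]] := split_root ra.
set r := a + n%:~R in rM hn.
have [l el] := closed_field_poly_normal M.
move: el; rewrite (monicP M_monic) scale1r => el.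
have hl z : z \in l -> z = r.
  move=> zl; have rz : root M z by rewrite el root_prod_XsubC.
  have [|k hk] := hZ z; first by rewrite P_eq rootM rz.
  have zr : z = r + (k - n)%:~R.
    by rewrite intrB -hk /r; ring.
  case: split => _ _ hM _; case: (k - n) zr => m zr.
    by have := hM r m rM; rewrite -zr => /(_ rz) m0; rewrite zr m0 addr0.
  have : r = z + m.+1%:R by rewrite zr NegzE mulrNz subrK.
  by move=> rz'; have := hM z m.+1 rz; rewrite -rz' => /(_ rM).
have lE : l = nseq (size l) r.
  by apply/all_pred1P/allP => z /hl ->; exact: eqxx.
have sM : size M = (size l).+1 by rewrite el size_prod_XsubC.
have mM : mup r M = size l.
  by rewrite el mu_prod_XsubC lE count_nseq size_nseq /= eqxx mul1n.
rewrite sM; congr S; apply/eqP; rewrite eqn_leq -{2}mM hn andbT -mM.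
apply: leq_trans (hm r _); last by rewrite P_eq rootM rM.
by rewrite P_eq mupM // leq_addr.
Qed.

Lemma split_simple : (1 < size P)%N -> size M = 2%N <->
  (forall a, root P a -> mup a P = 1%N) /\
  exists a0, forall a, root P a -> isZ (a - a0).
Proof.
move=> sP; split=> [sM|[hm [a0 ha]]]; last first.
  have [|x rx] := closed_rootP P _; first by rewrite gtn_eqF.
  rewrite (split_single_coset rx) ?hm // => b rb; last by rewrite !hm.
  have [n hn] := ha b rb; have [m hm'] := ha x rx.
  by exists (n - m); rewrite intrB -hn -hm'; ring.
have sM1 : size M != 1%N by rewrite sM.
have [c rc] := closed_rootP M sM1.
have Mr z : root M z -> z = c.
  move=> rz; apply/eqP/negPn/negP => zc.
  have := max_poly_roots M_neq0 (rs := [:: z; c]); rewrite /= rz rc inE zc sM.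
  by move=> /(_ isT isT).
split=> [a ra|].
  have [n [rM hn]] := split_root ra.
  apply/eqP; rewrite eqn_leq -XsubC_dvd // dvdp_XsubCl ra andbT.
  apply: leq_trans hn _; rewrite -ltnS -sM.
  have : ('X - (a + n%:~R)%:P) ^+ mup (a + n%:~R) M %| M by rewrite -mup_geq.
  by move=> /(dvdp_leq M_neq0); rewrite size_exp_XsubC.
exists c => a ra; have [n [/Mr <- _]] := split_root ra.
by exists (- n); rewrite mulrNz opprD addNKr.
Qed.

End Consequences.
End Splitting.

(** * The space of degenerate traces *)

Section DegenerateTraces.
Variable R : realType.
Local Notation C := (R[i]).
Local Notation functional := (functional R).
Variables (P M N : {poly C}) (t : C).
Hypotheses (P_monic : P \is monic) (split : coset_split P M N) (t_neq0 : t != 0).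
Implicit Types (T : functional) (q : {poly C}) (tau sigma rho : {poly C} -> C).

Let P_neq0 : P != 0. Proof. exact: monic_neq0. Qed.
Let P_eq : P = M * N. Proof. by case: split. Qed.
Let M_monic : M \is monic. Proof. by case: split. Qed.
Let M_neq0 : M != 0. Proof. exact: monic_neq0. Qed.

Lemma degenerate_tracesE T : degenerate_traces P t T <-> exists tau,
  [/\ lin tau, T = functional_of P 0 tau, fsupp tau &
      forall s, tau (tdiff t (P * s)) = 0].
Proof.
split=> [[tw dg]|[tau [tl -> ts h]]].
  have [tau [tl e h]] := trace_functional P_neq0 tw.
  by exists tau; split=> //; apply/(degenerate_fsupp P_neq0 tl); rewrite -e.
split; first exact: functional_trace.
exact/(degenerate_fsupp P_neq0 tl).
Qed.

Lemma functional_of_comb (c : C) tau sigma :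
  functional_of P 0 (fun q => c * tau q + sigma q) =
  fun w => c * functional_of P 0 tau w + functional_of P 0 sigma w.
Proof. by []. Qed.

Lemma functional_of_Xn tau k : functional_of P 0 tau (nseq k gz) = tau 'X^k.
Proof. by rewrite /functional_of /word_symbol_part gdeg_nseq_z word_symbol_nseq_z. Qed.

Lemma degenerate_traces_subspace : is_subspace (degenerate_traces P t).
Proof.
split.
  apply/degenerate_tracesE; exists (fun=> 0).
  by split; [exact: lin_zero| |exact: fsupp0|].
move=> c f g /degenerate_tracesE[tau [tl -> ts h]] /degenerate_tracesE[tau' [tl' -> ts' h']].
apply/degenerate_tracesE; exists (fun q => c * tau q + tau' q); split.
- exact: lin_comb.
- by rewrite functional_of_comb.
- exact: fsupp_comb.
- by move=> s; rewrite h h' mulr0 addr0.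
Qed.

Lemma exists_degenerate rho : lin rho -> (forall r, rho (N * r) = 0) ->
  exists tau, [/\ lin tau, fsupp tau & forall s, tau (tdiff t (M * s)) = rho s].
Proof.
move=> rl hr; apply: (@fsupp_tdiff_surj _ t t_neq0 rho M N (rootsC P) (fun a => mup a P)) => //.
- exact: undup_uniq.
- by rewrite -P_eq -prod_rootsC.
by move=> a; rewrite mem_rootsC //; case: split => _ _ _; apply.
Qed.

Lemma degenerate_eq0 tau : lin tau -> fsupp tau ->
  (forall s, tau (tdiff t (M * s)) = 0) -> forall q, tau q = 0.
Proof. by case: split => _ _ hM _; move=> tl ts; apply: fsupp_tdiff_eq0 hM. Qed.

Lemma lin_modp_coef k : lin (fun q : {poly C} => (q %% N)`_k).
Proof. by move=> c p q; rewrite modpD modpZl coefD coefZ. Qed.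

Lemma degenerate_traces_dim n : size N = n.+1 -> has_dim (degenerate_traces P t) n.
Proof.
move=> sN; have N0 : N != 0 by rewrite -size_poly_eq0 sN.
(* The basis corresponds to the coefficient functionals of the remainder modulo [N], which are dual
   to the monomials ['X^i]; evaluating at [tdiff t (M * 'X^i)] isolates the coordinate [c i]. *)
have /choice[tau htau] : forall i : 'I_n, exists tau,
    [/\ lin tau, fsupp tau & forall s, tau (tdiff t (M * s)) = (s %% N)`_i].
  move=> i; apply: exists_degenerate; first exact: lin_modp_coef.
  by move=> r; rewrite modp_mulr coef0.
have tl i : lin (tau i) by case: (htau i).
have ts i : fsupp (tau i) by case: (htau i).
have th i s : tau i (tdiff t (M * s)) = (s %% N)`_i by case: (htau i).
exists (fun i => functional_of P 0 (tau i)); split=> [i|]; [|split=> [c hc i|f]].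
- apply/degenerate_tracesE; exists (tau i); split=> // s.
  by rewrite P_eq -mulrA th modp_mulr coef0.
- have sl := lin_sum_fun c tl.
  have z q : \sum_i c i * tau i q = 0.
    rewrite (lin_coef sl) big1 // => k _; rewrite (_ : \sum_i _ = 0) ?mulr0 //.
    apply: etrans (hc (nseq k gz)); apply: eq_bigr => j _.
    by rewrite functional_of_Xn.
  have := z (tdiff t (M * 'X^i)); rewrite (bigD1 i) //= th modp_small; last first.
    by rewrite size_polyXn sN ltnS ltn_ord.
  rewrite coefXn eqxx mulr1 big1 ?addr0 // => j ji.
  rewrite th modp_small ?size_polyXn ?sN ?ltnS ?ltn_ord // coefXn.
  by rewrite (_ : (_ == _) = false) ?mulr0 //; apply/eqP => /val_inj e; rewrite e eqxx in ji.
move=> /degenerate_tracesE[sigma [sl -> ss h]].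
pose rho s := sigma (tdiff t (M * s)).
have rl : lin rho by move=> c p q; rewrite /rho mulrDr -scalerAr tdiff_lin sl.
have rN r : rho (N * r) = 0 by rewrite /rho mulrA -P_eq h.
(* With these coordinates, [sigma] and the combination agree on all [tdiff t (M * s)], so
   [degenerate_eq0] makes their difference vanish. *)
exists (fun i => rho 'X^i) => w; rewrite /functional_of; set q := word_symbol_part _ _ _.
apply/esym/eqP; rewrite -subr_eq0 -oppr_eq0 opprB addrC -mulN1r; apply/eqP.
move: q; apply: degenerate_eq0.
- by apply: lin_comb => //; apply: lin_sum_fun.
- by apply: fsupp_comb => //; apply: fsupp_sum.
move=> s; rewrite -/(rho s) mulN1r addrC; apply/eqP; rewrite subr_eq0; apply/eqP.
rewrite {1}(divp_eq s N) (linD rl) mulrC rN add0r (lin_coef rl).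
have sm : (size (s %% N)%R <= n)%N by rewrite -ltnS -sN ltn_modp.
rewrite (big_ord_widen n (fun i => (s %% N)`_i * rho 'X^i)) // big_mkcond.
apply: eq_bigr => i _; rewrite th mulrC; case: ltnP => // h'.
by rewrite nth_default ?mulr0.
Qed.

(** Lift [sigma] to [tau] through [tdiff]. Were the trace degenerate, [tau] would have finite
    support and vanish by [degenerate_eq0], contradicting [sigma q != 0]. *)
Lemma exists_nondegenerate sigma q : lin sigma -> (forall s, sigma (M * s) = 0) ->
  (forall p, tdiff t p = 0 -> sigma p = 0) -> sigma q != 0 ->
  exists T : functional, nondegenerate_trace P t T.
Proof.
move=> sl sM sk sq; have [tau tl h] := lift_tdiff sl sk.
exists (functional_of P 0 tau); split.
  by apply: functional_trace => // s; rewrite h P_eq -mulrA sM.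
move=> /(degenerate_fsupp P_neq0 tl) ts; case/eqP: sq; rewrite -h.
by apply: degenerate_eq0 => // s; rewrite h sM.
Qed.

Lemma exists_nondegenerate_neq1 : (1 < size M)%N -> t != 1 ->
  exists T : functional, nondegenerate_trace P t T.
Proof.
move=> sM t1; apply: (@exists_nondegenerate (fun q => (q %% M)`_0) 1).
- by move=> c p q; rewrite modpD modpZl coefD coefZ.
- by move=> s; rewrite modp_mulr coef0.
- by move=> p /(tdiff_ker_neq1 t1) ->; rewrite mod0p coef0.
by rewrite modp_small ?size_poly1 // coef1 oner_neq0.
Qed.

Lemma exists_nondegenerate_eq1 : (2 < size M)%N -> t = 1 ->
  exists T : functional, nondegenerate_trace P t T.
Proof.
(* The coefficient of ['X] in the remainder kills the constants, the kernel of [tdiff 1]; it is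
   nonzero at ['X] because [M] has degree at least 2. *)
move=> sM t1; apply: (@exists_nondegenerate (fun q => (q %% M)`_1) 'X).
- by move=> c p q; rewrite modpD modpZl coefD coefZ.
- by move=> s; rewrite modp_mulr coef0.
- move=> p; rewrite t1 => /tdiff_ker1[c ->]; rewrite modp_small ?coefC //.
  by rewrite (leq_ltn_trans (size_polyC_leq1 _)) // ltnW.
by rewrite modp_small ?size_polyX // coefX oner_neq0.
Qed.

(** Since [M] is linear, every polynomial is a multiple of [M] plus a constant, and [tdiff 1] kills
    constants. So [tau] equals the finitely supported [sigma] that agrees with it on all
    [tdiff t (M * s)]. *)
Lemma trace1_degenerate T : size M = 2%N -> t = 1 -> twisted_trace P t T ->
  degenerate P T.
Proof.
move=> sM t1 /(trace_functional P_neq0)[tau [tl -> h]].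
pose rho s := tau (tdiff t (M * s)).
have rl : lin rho by move=> c p q; rewrite /rho mulrDr -scalerAr tdiff_lin tl.
have [|sigma [sl ss hs]] := exists_degenerate rl.
  by move=> r; rewrite /rho mulrA -P_eq h.
apply/(degenerate_fsupp P_neq0 tl); suff -> : tau = sigma by [].
apply/funext => q; have [p <-] := tdiff_surj t q.
rewrite (divp_eq p M) [p %/ M * M]mulrC tdiffD (linD tl) (linD sl) hs; congr (_ + _).
have : (size (p %% M)%R <= 1)%N by rewrite -ltnS -sM ltn_modp.
move=> /size1_polyC ->; rewrite t1 /tdiff scale1r !shiftpC subrr.
by rewrite (lin0 tl) (lin0 sl).
Qed.

End DegenerateTraces.

(** * Polynomials realizing every value of delta *)

Section Extremal.
Variable R : realType.
Local Notation C := (R[i]).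

Lemma deltaP_single_coset (P : {poly C}) a : P \is monic -> root P a ->
  (forall b, root P b -> isZ (b - a)) ->
  (forall b, root P b -> (mup b P <= mup a P)%N) ->
  deltaP P = ((size P).-1 - mup a P)%N.
Proof.
move=> mP ra hZ hm; have [M [N [sp sN]]] := coset_split_exists mP.
have := split_size mP sp; rewrite (split_single_coset mP sp ra hZ hm) sN => ->.
by rewrite addSn addnS /= addKn.
Qed.

(** The witness is [X^(d-k) (X-1) ... (X-k)]: its roots form one coset, and the maximal multiplicity
    [d - k] is attained at 0. *)
Lemma deltaP_surj (d k : nat) : (1 <= d)%N -> (k <= d.-1)%N ->
  exists Q : {poly C}, [/\ Q \is monic, size Q = d.+1 & deltaP Q = k].
Proof.
move=> d0 kd; pose m := (d - k)%N.
pose l : seq C := [seq i.+1%:R | i <- iota 0 k].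
have ul : uniq l by rewrite map_inj_uniq ?iota_uniq // => i j /eqP; rewrite eqr_nat => /eqP [].
pose A : {poly C} := 'X^m; pose B := \prod_(z <- l) ('X - z%:P).
have mA : A \is monic by exact: monicXn.
have mB : B \is monic by exact: monic_prod_XsubC.
have mQ : A * B \is monic by rewrite monicMl.
have sQ : size (A * B) = d.+1.
  rewrite size_monicM ?monic_neq0 // size_polyXn size_prod_XsubC size_map size_iota.
  by rewrite /m; lia.
have l0 : 0 \notin l by apply/mapP => -[i _ /esym/eqP]; rewrite pnatr_eq0.
have mup0 : mup 0 (A * B) = m.
  rewrite mupM ?monic_neq0 // /B mu_prod_XsubC /A -['X]subr0 -polyC0 mup_XsubCX eqxx.
  by rewrite (count_memPn l0) addn0.
have r0 : root (A * B) 0.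
  by rewrite -dvdp_XsubCl XsubC_dvd ?monic_neq0 // mup0 /m; lia.
exists (A * B); split=> //; rewrite (deltaP_single_coset mQ r0) ?mup0 ?sQ /m; first by lia.
  move=> b; rewrite subr0 rootM => /orP[|].
    rewrite /root hornerXn expf_eq0 => /andP[_ /eqP ->]; by exists 0.
  by rewrite root_prod_XsubC => /mapP[i _ ->]; exists i.+1.
move=> b rb; have [->|b0] := eqVneq b 0; first by rewrite mup0.
rewrite mupM ?monic_neq0 // /B mu_prod_XsubC /A -['X]subr0 -polyC0 mup_XsubCX.
rewrite eq_sym (negPf b0) add0n count_uniq_mem //; case: (b \in l) => /=; lia.
Qed.

End Extremal.

(** * Assembly of the results *)

Unset Implicit Arguments.

Theorem theoremA (R : realType) (P : {poly R[i]}) (t : R[i]) :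
  P \is monic -> (1 < size P)%N -> t != 0 ->
  let d := (size P).-1 in
  (* D_{P,t} is a linear subspace (of C_{P,t}) of dimension delta(P) *)
  (is_subspace (degenerate_traces P t) /\ has_dim (degenerate_traces P t) (deltaP P)) /\
  (* (i) *)
  ((0 <= deltaP P)%N /\ (deltaP P <= d.-1)%N) /\
  (forall d' k : nat, (1 <= d')%N -> (k <= d'.-1)%N ->
     exists Q : {poly R[i]}, Q \is monic /\ size Q = d'.+1 /\ deltaP Q = k /\
       forall t' : R[i], t' != 0 -> has_dim (degenerate_traces Q t') k) /\
  (* (ii) *)
  (deltaP P = 0%N <->
     forall a b : R[i], root P a -> root P b -> a != b -> ~ isZ (a - b)) /\
  (* (iii) *)
  (deltaP P = d.-1 <->
     (forall a : R[i], root P a -> mup a P = 1%N) /\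
     exists a0 : R[i], forall a : R[i], root P a -> isZ (a - a0)) /\
  (* consequences *)
  (t != 1 -> exists T : functional R, nondegenerate_trace P t T) /\
  (t = 1 ->
     ((exists T : functional R, nondegenerate_trace P 1 T) <-> (deltaP P < d.-1)%N) /\
     ((deltaP P < d.-1)%N <->
        (exists a : R[i], root P a /\ (1 < mup a P)%N) \/
        (exists a b : R[i], root P a /\ root P b /\ ~ isZ (a - b)))).
Proof.
move=> P_monic P_size t_neq0 d.
have [M [N [sp sN]]] := coset_split_exists P_monic.
have sM := split_sizel P_monic sp P_size.
have dE : d = ((size M).-1 + deltaP P)%N.
  by rewrite /d (split_size P_monic sp) sN; lia.
(* As [d] is the degree of [M] plus delta and [M] is nonconstant, delta is at most [d - 1], with
   equality exactly when [M] is linear. *)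
have maxE : deltaP P = d.-1 <-> size M = 2 by split; lia.
have simpleE := split_simple P_monic sp P_size.
split; first split.
- exact: degenerate_traces_subspace.
- exact: (degenerate_traces_dim P_monic sp t_neq0 sN).
split; first by split=> //; lia.
split.
  move=> d' k d'_gt0 kd; have [Q [mQ sQ dQ]] := deltaP_surj R d'_gt0 kd.
  exists Q; split=> //; split=> //; split=> // t' t'_neq0.
  have [M' [N' [sp' sN']]] := coset_split_exists mQ.
  by apply: (degenerate_traces_dim mQ sp' t'_neq0); rewrite sN' dQ.
split; first by rewrite -(split_trivial P_monic sp) sN; split=> [->|[]].
split; first by rewrite maxE.
split; first exact: (exists_nondegenerate_neq1 P_monic sp t_neq0 sM).
move=> t1; rewrite t1 in t_neq0 *; split; split.
- move=> [T [tw ndg]]; rewrite ltnNge; apply/negP => le_d; apply: ndg.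
  by apply: (trace1_degenerate P_monic sp t_neq0) tw => //; lia.
- by move=> lt_d; apply: (exists_nondegenerate_eq1 P_monic sp t_neq0) => //; lia.
- move=> lt_d; apply: contrapT => none.
  have : size M = 2; last by lia.
  apply/simpleE; split=> [a ra|].
    apply/eqP; rewrite eqn_leq -XsubC_dvd ?monic_neq0 // dvdp_XsubCl ra andbT leqNgt.
    by apply/negP => ma; apply: none; left; exists a.
  have [|x rx] := closed_rootP P _; first by rewrite gtn_eqF.
  exists x => a ra; apply: contrapT => nZ; apply: none; right.
  by exists a, x.
move=> multi; rewrite ltn_neqAle; apply/andP; split; last by lia.
apply/eqP => /maxE/simpleE[simple [a0 Z0]]; case: multi => [[a [ra]]|[a [b [ra [rb]]]]].
  by rewrite simple.
apply; have [n hn] := Z0 a ra; have [m hm] := Z0 b rb.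
by exists (n - m); rewrite intrB -hn -hm; ring.
Qed.
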